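(* Let $\frac12\le H_1<H_2<1$ and $T>0$, and let $\kappa$ be the kernel defined in the context. Then the integral operator $$(\kappa x)(u)=\int_0^T\kappa(s,u)\,x(s)\,ds,\qquad u\in[0,T],\ x\in C[0,T],$$ maps $C[0,T]$ into $C[0,T]$ and is a compact operator $C[0,T]\to C[0,T]$.
   Context: $C[0,T]$ is the Banach space of continuous real-valued functions on $[0,T]$ with the supremum norm. $\mathrm{B}(\alpha,\beta)=\int_0^1x^{\alpha-1}(1-x)^{\beta-1}dx$ is the beta function, and $\beta_H=\left(\frac{H(2H-1)}{\mathrm{B}(H-1/2,\,2-2H)}\right)^{1/2}$. For $0<s<t$ put $$K_{H_1,H_2}(t,s)=\beta_{H_2}s^{1/2-H_2}\int_s^t(t-u)^{1/2-H_1}u^{H_2-H_1}(u-s)^{H_2-3/2}\,du .$$ For $s,u>0$, $s\ne u$, put $$k(s,u)=\int_0^{s\wedge u}\partial_sK_{H_1,H_2}(s,v)\,\partial_uK_{H_1,H_2}(u,v)\,dv,$$ where $\partial_s K_{H_1,H_2}(s,v)$ and $\partial_u K_{H_1,H_2}(u,v)$ denote derivatives with respect to the first argument of $K_{H_1,H_2}$, and $s\wedge u=\min(s,u)$. Put $$\kappa(s,u)=u^{2H_1-1}k(s,u).$$ Conventions on a null set: $\kappa(s,s)=0$, and $\kappa(s,0)=\lim_{u\downarrow0}\kappa(s,u)$ for $s>0$. *)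

(* Defs.v *)
From HB Require Import structures.
From mathcomp Require Import all_boot all_order all_algebra.
From mathcomp Require Import all_classical all_reals all_analysis.
From mathcomp Require Import ring lra.
Import Order.TTheory GRing.Theory Num.Theory.
Import numFieldNormedType.Exports.

Set Implicit Arguments.
Unset Strict Implicit.
Unset Printing Implicit Defensive.

Local Open Scope classical_set_scope.
Local Open Scope ring_scope.

Section continuous_pointwise.
Context {R : realType} {X : topologicalType}.
Implicit Types f g : X -> R.

Lemma continuous_opp f : continuous f -> continuous (fun x => - f x).
Proof. by move=> cf x; apply: (@cvgN _ R^o); exact: cf. Qed.

Lemma continuous_add f g :
  continuous f -> continuous g -> continuous (fun x => f x + g x).
Proof. by move=> cf cg x; apply: (@cvgD _ R^o); [exact: cf|exact: cg]. Qed.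

Lemma continuous_scale (a : R) f :
  continuous f -> continuous (fun x => a * f x).
Proof. by move=> cf x; apply: (@cvgZr _ R^o); exact: cf. Qed.

Lemma continuous_unif_lim f :
  (forall e, 0 < e ->
    exists g : X -> R, continuous g /\ forall x, `|g x - f x| < e) ->
  continuous f.
Proof.
move=> fg x; apply/(@cvgrPdist_lt _ R^o) => e e0.
have e30 : 0 < e / 3 by rewrite divr_gt0.
have [g [cg gf]] := fg _ e30.
have /(@cvgrPdist_lt _ R^o) /(_ _ e30) := cg x.
apply: filterS => y gxy.
have -> : f x - f y = - (g x - f x) + (g x - g y) + (g y - f y) by ring.
have -> : e = e / 3 + e / 3 + e / 3 by field.
rewrite (le_lt_trans (ler_normD _ _))// ltrD//.
by rewrite (le_lt_trans (ler_normD _ _))// normrN ltrD.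
Qed.

End continuous_pointwise.

(* C[0,T]: the library's continuous functions on the subspace [0,T] of R. *)
Definition C0T (R : realType) (T : R) : Type := continuousType `[0, T]%classic R.

Section C0T_lmodule.
Context {R : realType} {T : R}.
Implicit Types f g h : C0T T.

HB.instance Definition _ := Choice.copy (C0T T) (continuousType `[0, T]%classic R).

Definition C0T_fun (f : C0T T) : `[0, T]%classic -> R := @Continuous.sort _ _ f.

Coercion C0T_fun : C0T >-> Funclass.

Lemma C0T_continuous f : continuous (f : `[0, T]%classic -> R).
Proof. exact: cts_fun. Qed.

Lemma C0TP f g : f = g <-> (f : _ -> _) =1 g.
Proof. exact: continuousEP. Qed.

Definition mkC0T (f : `[0, T]%classic -> R) (cf : continuous f) : C0T T :=
  [the continuousType _ _ of mkcts cf].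

Let zero_cts : continuous (fun _ : `[0, T]%classic => 0 : R).
Proof. exact: (@cst_continuous _ R). Qed.

Let opp_cts f : continuous (fun x => - f x).
Proof. exact/continuous_opp/C0T_continuous. Qed.

Let add_cts f g : continuous (fun x => f x + g x).
Proof. by apply: continuous_add; exact: C0T_continuous. Qed.

Let scale_cts a f : continuous (fun x => a * f x).
Proof. exact/continuous_scale/C0T_continuous. Qed.

Definition C0T_zero : C0T T := mkC0T zero_cts.
Definition C0T_opp f : C0T T := mkC0T (@opp_cts f).
Definition C0T_add f g : C0T T := mkC0T (@add_cts f g).
Definition C0T_scale (a : R) f : C0T T := mkC0T (@scale_cts a f).

Let addA : associative C0T_add.
Proof. by move=> f g h; apply/C0TP => x; exact: addrA. Qed.
Let addC : commutative C0T_add.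
Proof. by move=> f g; apply/C0TP => x; exact: addrC. Qed.
Let add0 : left_id C0T_zero C0T_add.
Proof. by move=> f; apply/C0TP => x; exact: add0r. Qed.
Let addN : left_inverse C0T_zero C0T_opp C0T_add.
Proof. by move=> f; apply/C0TP => x; exact: addNr. Qed.

HB.instance Definition _ := GRing.isZmodule.Build (C0T T) addA addC add0 addN.

Let scaleA a b f : C0T_scale a (C0T_scale b f) = C0T_scale (a * b) f.
Proof. by apply/C0TP => x; exact: mulrA. Qed.
Let scale1 : left_id 1 C0T_scale.
Proof. by move=> f; apply/C0TP => x; exact: mul1r. Qed.
Let scaleDr : right_distributive C0T_scale +%R.
Proof. by move=> a f g; apply/C0TP => x; exact: mulrDr. Qed.
Let scaleDl f : {morph C0T_scale^~ f : a b / a + b}.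
Proof. by move=> a b; apply/C0TP => x; exact: mulrDl. Qed.

HB.instance Definition _ :=
  GRing.Zmodule_isLmodule.Build R (C0T T) scaleA scale1 scaleDr scaleDl.

End C0T_lmodule.

Section C0T_norm.
Context {R : realType} {T : R}.
Implicit Types f g : C0T T.

Definition sup_norm f : R := sup (range (fun x => `|f x|)).

Lemma C0T_has_ubound f : has_ubound (range (fun x => `|f x|)).
Proof.
have [T0|T0] := leP 0 T; last first.
  exists 0 => _ [[x xT] _ <-]; exfalso; move: xT.
  by rewrite set_itv_ge ?inE// bnd_simp -ltNge.
have cf : {within `[0, T], continuous (Num.norm \o 'valL_0 f)}.
  move=> x; apply: (@continuous_comp (subspace _) R R); last first.
    exact: (@norm_continuous _ R^o).
  move: x; apply/subspace_sigL_continuousP.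
  by rewrite valLK; exact: C0T_continuous.
have [c _ fc] := EVT_max T0 cf.
exists (`|'valL_0 f c|) => _ [x _ <-].
have fxE : f x = 'valL_0 f (set_val x).
  by rewrite -[LHS]/((f : _ -> _) x) -{1}(valLK 0 f).
by rewrite [in leLHS]fxE; exact: fc (set_mem (valP x)).
Qed.

Lemma sup_norm_ge f x : `|f x| <= sup_norm f.
Proof. by apply: ub_le_sup; [exact: C0T_has_ubound|exists x]. Qed.

Lemma sup_norm_le f M : 0 <= M -> (forall x, `|f x| <= M) -> sup_norm f <= M.
Proof.
move=> M0 fM; rewrite /sup_norm.
have [->|/set0P ne] := eqVneq (range (fun x => `|f x|)) set0.
  by rewrite sup0.
by apply: ge_sup => // _ [x _ <-].
Qed.

Lemma sup_norm_ge0 f : 0 <= sup_norm f.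
Proof.
rewrite /sup_norm.
have [->|/set0P[y [x _ _]]] := eqVneq (range (fun x => `|f x|)) set0.
  by rewrite sup0.
by apply: le_trans (sup_norm_ge f x).
Qed.

Let sup_normD f g : sup_norm (f + g) <= sup_norm f + sup_norm g.
Proof.
apply: sup_norm_le => [|x]; first by rewrite addr_ge0 ?sup_norm_ge0.
by rewrite (le_trans (ler_normD _ _))// lerD ?sup_norm_ge.
Qed.

Let sup_normZ_le a f : sup_norm (a *: f) <= `|a| * sup_norm f.
Proof.
apply: sup_norm_le => [|x]; first by rewrite mulr_ge0 ?sup_norm_ge0.
have -> : (a *: f : C0T T) x = a * f x by [].
by rewrite normrM ler_wpM2l ?sup_norm_ge.
Qed.

Let sup_normZ a f : sup_norm (a *: f) = `|a| * sup_norm f.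
Proof.
apply/eqP; rewrite eq_le sup_normZ_le/=.
have [->|a0] := eqVneq a 0; first by rewrite normr0 mul0r sup_norm_ge0.
have := sup_normZ_le a^-1 (a *: f).
rewrite scalerA mulVf// scale1r normfV.
by rewrite ler_pdivlMl ?normr_gt0.
Qed.

Let sup_norm0_eq0 f : sup_norm f = 0 -> f = 0.
Proof.
move=> f0; apply/C0TP => x; apply/eqP; rewrite -normr_le0 -f0.
exact: sup_norm_ge.
Qed.

HB.instance Definition _ :=
  Lmodule_isNormed.Build R (C0T T) sup_normD sup_normZ sup_norm0_eq0.

Lemma C0T_normE f : `|f| = sup_norm f.
Proof. by []. Qed.

End C0T_norm.

Section C0T_complete.
Context {R : realType} {T : R}.

Lemma C0T_complete (F : set_system (C0T T)) :
  ProperFilter F -> cauchy F -> cvg F.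
Proof.
move=> FF /cauchy_ballP Fc.
have Fx x (e : R) : 0 < e -> \forall f & g \near F, `|C0T_fun f x - C0T_fun g x| < e.
  move=> e0; apply: filterS (Fc e e0) => -[f g]; rewrite -ball_normE /= => fg.
  exact: le_lt_trans (sup_norm_ge (f - g) x) fg.
pose l x : R := lim (C0T_fun f x @[f --> F]).
have cl x : C0T_fun f x @[f --> F] --> l x.
  apply: (@cauchy_cvg R^o); apply/cauchy_ballP => e e0.
  have [[A B] [/= FA FB] AB] := Fx x e e0.
  exists ((fun f : C0T T => f x) @` A, (fun f : C0T T => f x) @` B).
    by split => /=; [apply: filterS FA|apply: filterS FB] => f ?; exists f.
  move=> [_ _] [[f Af <-] [g Bg <-]]; rewrite /= -ball_normE /=.
  exact: (AB (f, g)).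
have ul (e : R) : 0 < e -> \forall f \near F, forall x, `|C0T_fun f x - l x| < e.
  move=> e0; have e20 : 0 < e / 2 by rewrite divr_gt0.
  have [[A B] [/= FA FB] AB] := Fc _ e20.
  apply: filterS FA => f Af x.
  have := cl x => /(@cvgrPdist_lt _ R^o) /(_ _ e20) lx.
  have [g [Bg /= gx]] := filter_ex (filterI FB lx).
  have := AB (f, g) (conj Af Bg); rewrite -ball_normE /= => fg.
  rewrite (splitr e) (le_lt_trans (ler_distD (C0T_fun g x) _ _))// ltrD//.
    exact: le_lt_trans (sup_norm_ge (f - g) x) fg.
  by rewrite distrC.
have l_cts : continuous l.
  apply: continuous_unif_lim => e e0; have [f fl] := filter_ex (ul _ e0).
  by exists f; split=> //; exact: C0T_continuous.
apply/cvg_ex; exists (mkC0T l_cts); apply/cvgrPdist_le => e e0.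
apply: filterS (ul e e0) => f fl; apply: sup_norm_le => [|x]; first exact: ltW.
by rewrite distrC; exact/ltW/fl.
Qed.

HB.instance Definition _ := Uniform_isComplete.Build (C0T T) C0T_complete.

End C0T_complete.

Section compact_integral_operator.
Context {R : realType}.
Local Notation mu := (@lebesgue_measure R).

Definition compact_operator (V W : normedModType R) (A : {linear V -> W}) :=
  forall B : set V, bounded_set B -> precompact (A @` B).

(* ['valL_0 x] extends [x] by 0 outside [0,T]. The integrability clause is
   needed because the integral is a total function of its integrand. *)
Definition is_integral_operator (T : R) (kap : R -> R -> R)
    (A : C0T T -> C0T T) :=
  forall (x : C0T T) (u : `[0, T]%classic),
    let f s := kap s (set_val u) * 'valL_0 x s in
    mu.-integrable `[0, T] (EFin \o f) /\
    A x u = \int[mu]_(s in `[0, T]) f s.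

End compact_integral_operator.

Section kernel.
Context {R : realType}.
Local Notation mu := (@lebesgue_measure R).

Definition Beta (a b : R) : R :=
  \int[mu]_(x in `[0, 1]) (x `^ (a - 1) * (1 - x) `^ (b - 1)).

Definition beta_coef (H : R) : R :=
  Num.sqrt (H * (2 * H - 1) / Beta (H - 1 / 2) (2 - 2 * H)).

(* Meaningful for 0 < s < t only. *)
Definition K (H1 H2 t s : R) : R :=
  beta_coef H2 * s `^ (1 / 2 - H2) *
  \int[mu]_(u in `[s, t])
    ((t - u) `^ (1 / 2 - H1) * u `^ (H2 - H1) * (u - s) `^ (H2 - 3 / 2)).

Definition dK (H1 H2 t s : R) : R := derive1 (fun t' => K H1 H2 t' s) t.

Definition kker (H1 H2 s u : R) : R :=
  \int[mu]_(v in `]0, Num.min s u[) (dK H1 H2 s v * dK H1 H2 u v).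

(* At s = 0 < u the interval in [kker] is empty, hence [kappa H1 H2 0 u = 0];
   s = 0 is a null set for the integration in s. *)
Definition kappa (H1 H2 s u : R) : R :=
  let kap u := u `^ (2 * H1 - 1) * kker H1 H2 s u in
  if s == u then 0
  else if u == 0 then lim (kap u' @[u' --> 0^'+])
  else kap u.

End kernel.

(* Main.v *)
(* Put a = H2 - H1. Substituting u = s + (t - s) y in K and differentiating under
   the integral gives dK(t, s) = beta a s^(1/2 - H2) (t - s)^(a - 1) N(t, s) with N
   bounded, continuous and homogeneous of degree a. Substituting v = u z in the
   integral defining k, homogeneity makes all powers of u cancel against
   u^(2 H1 - 1), so that
     kappa(s, u) = int_0^1 p(z) M(s, u z) dz,
     M(s, v) = 1_(v < s) (s - v)^(a - 1) N(s, v),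
   with p >= 0 integrable; this also covers u = 0. By Scheffe's lemma
   v |-> M(., v) is continuous into L1, hence by Tonelli and dominated convergence
   so is u |-> kappa(., u). The images of a ball of C[0, T] are therefore pointwise
   bounded and equicontinuous, and Arzela-Ascoli applies. *)
Require Import Defs.
From HB Require Import structures.
From mathcomp Require Import all_boot all_order all_algebra.
From mathcomp Require Import all_classical all_reals all_analysis.
From mathcomp Require Import measurable_realfun.
From mathcomp Require Import ring lra.
Import Order.TTheory GRing.Theory Num.Theory.
Import numFieldNormedType.Exports.

Local Open Scope classical_set_scope.
Local Open Scope ring_scope.

Set Implicit Arguments.
Unset Strict Implicit.
Unset Printing Implicit Defensive.

(** The obstacle is that the singularity of M(., v) sits at s = v and moves with v: for v' near v
    the functions (s - v')^(a - 1) have no common integrable majorant, so dominated convergence does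
    not apply to them directly. Translating by s = v + r freezes the singularity at r = 0 and gives
    a majorant for all v at once, but this controls only the integrals of M(., v). Scheffe's lemma
    combines the two views: pointwise limits in the variable s, convergence of masses in the
    variable r. Rescaling K to a fixed interval serves a similar purpose. The endpoint t then enters
    only through (t - s)^a and through powers of a base that is at least s > 0, and both can be
    differentiated. In the averaged form u occurs only in M(., u z), and u z stays in [0, T]. Hence
    u = 0 is an ordinary point for the L1 estimates; only the identification of [kappa] there,
    defined as a limit, needs its own argument. *)

Lemma integrable_EFinD d (X : measurableType d) (R : realType)
    (mu : {measure set X -> \bar R}) (D : set X) (f g : X -> R) :
  measurable D -> mu.-integrable D (EFin \o f) -> mu.-integrable D (EFin \o g) ->
  mu.-integrable D (EFin \o (fun s => f s + g s)).
Proof.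
move=> mD jf ig; rewrite /comp; under eq_fun do rewrite EFinD.
exact: integrableD.
Qed.

Lemma integrable_EFinB d (X : measurableType d) (R : realType)
    (mu : {measure set X -> \bar R}) (D : set X) (f g : X -> R) :
  measurable D -> mu.-integrable D (EFin \o f) -> mu.-integrable D (EFin \o g) ->
  mu.-integrable D (EFin \o (fun s => f s - g s)).
Proof.
move=> mD jf ig; rewrite /comp; under eq_fun do rewrite EFinB.
exact: integrableB.
Qed.

Lemma integrable_EFinZl d (X : measurableType d) (R : realType)
    (mu : {measure set X -> \bar R}) (D : set X) (c : R) (g : X -> R) :
  measurable D -> mu.-integrable D (EFin \o g) ->
  mu.-integrable D (EFin \o (fun s => c * g s)).
Proof.
move=> mD ig; rewrite /comp; under eq_fun do rewrite EFinM.
exact: integrableZl.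
Qed.

Lemma continuous_near (R : realType) (X : topologicalType) (f : X -> R) :
  (forall x e, 0 < e -> \forall y \near x, `|f x - f y| < e) -> continuous f.
Proof. by move=> fn x; apply/(@cvgrPdist_lt _ R^o) => e e0; exact: fn. Qed.

Lemma set_val_itv (R : realType) (T : R) (x : `[0, T]%classic) :
  set_val x \in `[0, T].
Proof. exact: (set_mem (valP x)). Qed.

(** * Arzela-Ascoli in C[0, T] *)

Section C0T_arzela_ascoli.
Context {R : realType} {T : R}.
Variables (C : R -> R) (om : R -> R -> R).
Hypothesis om_small : forall x e, x \in `[0, T] -> 0 < e ->
  \forall y \near x, y \in `[0, T] -> om x y < e.

Let S : set (C0T T) := [set f | (forall x, `|f x| <= C (set_val x)) /\
  forall x y, `|f x - f y| <= om (set_val x) (set_val y)].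

(** The bound and the modulus are closed conditions, so they pass to pointwise limits and the set
    itself is compact. Along an ultrafilter, pointwise limits come from compactness of a segment;
    the common modulus makes the convergence uniform. *)
Lemma compact_equicontinuous : compact S.
Proof.
rewrite compact_ultra => F UF FS.
have PF : ProperFilter F by exact: ultra_proper.
have /choice[l fl] : forall x : `[0, T]%classic,
    exists l : R, C0T_fun f x @[f --> F] --> l.
  move=> x.
  have cC : compact (`[- C (set_val x), C (set_val x)]%classic : set R).
    exact: segment_compact.
  have FC : ((fun f : C0T T => C0T_fun f x) @ F) `[- C (set_val x), C (set_val x)]%classic.
    by apply: (@filterS _ F _ S) => // f [fC _]; rewrite /= in_itv/= -ler_norml.
  have [l [_ Fl]] := cC _ (fmap_proper_filter _ PF) FC; exists l => U lU.
  (* An ultrafilter contains [U] or its complement, and the complement is excluded because [l] is a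
     cluster point. *)
  have [//|FnU] := in_ultra_setVsetC ((fun f : C0T T => C0T_fun f x) @^-1` U) UF.
  by have [y []] := Fl (~` U) U FnU lU.
have lom x y : `|l x - l y| <= om (set_val x) (set_val y).
  apply: (@closed_cvg _ _ F PF (fun f : C0T T => `|C0T_fun f x - C0T_fun f y|)
    [set r | r <= om (set_val x) (set_val y)]).
  - exact: closed_le.
  - by apply: filterS FS => f [_]; exact.
  - by apply: (@cvg_norm _ R^o); apply: (@cvgB _ R^o); exact: fl.
have lC x : `|l x| <= C (set_val x).
  apply: (@closed_cvg _ _ F PF (fun f : C0T T => `|C0T_fun f x|)
    [set r | r <= C (set_val x)]).
  - exact: closed_le.
  - by apply: filterS FS => f [+ _]; exact.
  - by apply: (@cvg_norm _ R^o); exact: fl.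
have cl : continuous l.
  apply: continuous_near => x e e0.
  have sv : continuous (set_val : `[0, T]%classic -> R) by exact: initial_continuous.
  have := sv x _ (om_small (set_val_itv x) e0); rewrite nbhs_filterE => omx.
  near=> y.
  apply: le_lt_trans (lom x y) _.
  have : set_val y \in `[0, T] -> om (set_val x) (set_val y) < e.
    by near: y; exact: omx.
  by apply; exact: set_val_itv.
exists (mkC0T cl); split; first by split.
apply/cvgrPdist_le => e e0.
have e30 : 0 < e / 3 by rewrite divr_gt0.
(* Near-covering replaces a finite subcover: a bound that holds near each point, eventually along
   [F], holds eventually on all of [0, T]. *)
have /compact_near_coveringP/near_covering_withinP cov :
  compact (`[0, T]%classic : set R) by exact: segment_compact.
have := @cov _ F (fun f y => forall x : `[0, T]%classic, set_val x = y ->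
  `|l x - C0T_fun f x| <= e) _.
move=> near_l.
have : \near F, `[0, T]%classic `<=` (fun y => forall x : `[0, T]%classic,
    set_val x = y -> `|l x - C0T_fun F x| <= e).
  apply: near_l => y yT.
  pose x : `[0, T]%classic := SigSub (mem_set yT).
  have yx : y \in `[0, T] := yT.
  have := fl x => /(@cvgrPdist_lt _ R^o) /(_ _ e30) lfx.
  exists ([set y' | y' \in `[0, T] -> om y y' < e / 3],
    [set f | S f /\ `|l x - C0T_fun f x| < e / 3]).
    by split; [exact: om_small|exact: filterI].
  move=> [y' f] [/= omy [[_ fom] lf]] y'T x' x'y'.
  have omx : om (set_val x) (set_val x') < e / 3 by rewrite x'y'; exact: omy.
  have -> : l x' - C0T_fun f x' =
    - (l x - l x') + (l x - C0T_fun f x) + (C0T_fun f x - C0T_fun f x') by ring.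
  have -> : e = e / 3 + e / 3 + e / 3 by field.
  rewrite (le_trans (ler_normD _ _))// lerD//; last first.
    exact/ltW/(le_lt_trans (fom _ _)).
  rewrite (le_trans (ler_normD _ _))// lerD ?normrN//; last exact: ltW.
  exact/ltW/(le_lt_trans (lom _ _)).
apply: filterS => f lf; apply: sup_norm_le => [|x]; first exact: ltW.
by apply: (lf (set_val x)) => //; exact: set_val_itv.
Unshelve. all: by end_near. Qed.

End C0T_arzela_ascoli.

(** * Integral operators on C[0, T] with a kernel continuous into L1 *)

Section C0T_extension.
Context {R : realType} {T : R}.
Implicit Types f : C0T T.

Lemma C0T_valLE f (x : `[0, T]%classic) : 'valL_0 f (set_val x) = f x.
Proof. by rewrite -[RHS]/((f : _ -> _) x) -[in RHS](valLK 0 f). Qed.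

Lemma C0T_valL_itv s : s \in `[0, T] ->
  exists x, set_val x = s /\ forall f : C0T T, 'valL_0 f s = f x.
Proof.
move=> sT; have sT' : `[0, T]%classic s by [].
pose x : `[0, T]%classic := SigSub (mem_set sT').
by exists x; split=> // g; rewrite -C0T_valLE.
Qed.

Lemma measurable_C0T f : measurable_fun `[0, T] ('valL_0 f : R -> R).
Proof.
apply: subspace_continuous_measurable_fun; first exact: measurable_itv.
apply/subspace_sigL_continuousP.
by rewrite valLK; exact: C0T_continuous.
Qed.

Lemma C0T_valL_le f s : s \in `[0, T] -> `|'valL_0 f s : R| <= `|f|.
Proof. by move=> /C0T_valL_itv[x [_ ->]]; exact: sup_norm_ge. Qed.

Lemma integrableM_C0T (g : R -> R) f :
  (@lebesgue_measure R).-integrable `[0, T] (EFin \o g) ->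
  (@lebesgue_measure R).-integrable `[0, T] (EFin \o (fun s => g s * 'valL_0 f s)).
Proof.
move=> ig; apply: (@integrableMl _ _ _ _ _ _ _ _ ig (measurable_C0T f)).
  exact: measurable_itv.
exists `|f|; split; first by rewrite num_real.
move=> M fM s sT /=; apply: le_trans (ltW fM); exact: C0T_valL_le.
Qed.

End C0T_extension.

Section integral_operator.
Context {R : realType} {T : R} (kap : R -> R -> R).
Local Notation mu := (@lebesgue_measure R).
Hypothesis ikap : forall u, u \in `[0, T] ->
  mu.-integrable `[0, T] (EFin \o kap^~ u).
Hypothesis ckap : forall u e, u \in `[0, T] -> 0 < e -> \forall u' \near u,
  u' \in `[0, T] -> \int[mu]_(s in `[0, T]) `|kap s u - kap s u'| < e.

Let Af (x : C0T T) (u : `[0, T]%classic) : R :=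
  \int[mu]_(s in `[0, T]) (kap s (set_val u) * 'valL_0 x s).

Let mulr_valL_le (g : R -> R) (x : C0T T) C :
  mu.-integrable `[0, T] (EFin \o g) -> `|x| <= C ->
  `|\int[mu]_(s in `[0, T]) (g s * 'valL_0 x s)| <=
    C * \int[mu]_(s in `[0, T]) `|g s|.
Proof.
move=> ig xC.
have ign : mu.-integrable `[0, T] (EFin \o (fun s => `|g s|)).
  exact: (integrable_norm ig).
apply: le_trans (le_normr_Rintegral _ (integrableM_C0T x ig)) _ => //.
rewrite -RintegralZl//; apply: le_Rintegral => //.
- exact: (integrable_norm (integrableM_C0T x ig)).
- exact: integrable_EFinZl.
- move=> s sT; rewrite normrM mulrC ler_wpM2r//.
  by apply: le_trans xC; exact: C0T_valL_le.
Qed.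

Let Af_le x u C : `|x| <= C ->
  `|Af x u| <= C * \int[mu]_(s in `[0, T]) `|kap s (set_val u)|.
Proof. by move=> xC; apply: mulr_valL_le => //; exact/ikap/set_val_itv. Qed.

Let AfB_le x u u' C : `|x| <= C -> `|Af x u - Af x u'| <=
  C * \int[mu]_(s in `[0, T]) `|kap s (set_val u) - kap s (set_val u')|.
Proof.
move=> xC; rewrite /Af -RintegralB//; try by apply: integrableM_C0T; exact/ikap/set_val_itv.
under eq_Rintegral do rewrite -mulrBl.
apply: mulr_valL_le => //.
by apply: integrable_EFinB => //; exact/ikap/set_val_itv.
Qed.

Let om_small C x e : 0 < C -> x \in `[0, T] -> 0 < e -> \forall y \near x,
  y \in `[0, T] -> C * \int[mu]_(s in `[0, T]) `|kap s x - kap s y| < e.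
Proof.
move=> C0 xT e0; have eC0 : 0 < e / C by rewrite divr_gt0.
have := ckap xT eC0; apply: filterS => y h /h.
by rewrite ltr_pdivlMr// mulrC.
Qed.

Let Af_continuous x : continuous (Af x).
Proof.
apply: continuous_near => u e e0.
have C0 : 0 < `|x| + 1 by rewrite ltr_wpDl.
have sv : continuous (set_val : `[0, T]%classic -> R) by exact: initial_continuous.
have := sv u _ (om_small C0 (set_val_itv u) e0); rewrite nbhs_filterE => omx.
near=> u'; apply: le_lt_trans (AfB_le u u' (_ : _ <= `|x| + 1)) _.
  by rewrite lerDl.
have h : set_val u' \in `[0, T] ->
    (`|x| + 1) * \int[mu]_(s in `[0, T]) `|kap s (set_val u) - kap s (set_val u')| < e.
  by near: u'; exact: omx.
by apply: h; exact: set_val_itv.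
Unshelve. all: by end_near. Qed.

Let A (x : C0T T) : C0T T := mkC0T (@Af_continuous x).

Let A_linear : linear A.
Proof.
move=> a x y; apply/C0TP => u.
rewrite -[LHS]/(Af (a *: x + y) u) -[RHS]/(a * Af x u + Af y u) /Af.
have ik z := integrableM_C0T z (ikap (set_val_itv u)).
rewrite -RintegralZl// -RintegralD//; last first.
  exact: integrable_EFinZl.
apply: eq_Rintegral => s; rewrite inE => /C0T_valL_itv[t [_ xt]].
have e : (a *: x + y : C0T T) t = a * x t + y t by [].
by rewrite !xt e mulrDr mulrCA.
Qed.

(** On a ball of radius C, the L1 norm and the L1 modulus of the kernel, multiplied by C, are a
    pointwise bound and a modulus of continuity for all images. *)
Lemma integral_operator_compact : exists A : {linear C0T T -> C0T T},
  is_integral_operator kap A /\ compact_operator A.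
Proof.
pose Alin : {linear C0T T -> C0T T} :=
  HB.pack A (GRing.isLinear.Build R (C0T T) (C0T T) *:%R A A_linear).
exists Alin; split.
  move=> x u /=; split=> //; apply: integrableM_C0T; apply: ikap.
  exact: set_val_itv.
move=> B [M [_ BM]].
(* Boundedness speaks only of radii strictly above [M], and the modulus needs a positive factor;
   this value satisfies both. *)
pose C := `|M| + 1.
have C0 : 0 < C by rewrite ltr_wpDl.
have BC x : B x -> `|x| <= C.
  by move=> Bx; apply: BM => //; rewrite (le_lt_trans (ler_norm _))// ltrDl.
have cS := @compact_equicontinuous R T
  (fun u => C * \int[mu]_(s in `[0, T]) `|kap s u|)
  (fun u u' => C * \int[mu]_(s in `[0, T]) `|kap s u - kap s u'|)
  (fun x e => @om_small C x e C0).
eexists; last first.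
  by split; [exact: cS|apply: compact_closed cS; exact: norm_hausdorff].
by move=> _ [x Bx <-]; split=> [u|u u']; [apply: Af_le|apply: AfB_le]; exact: BC.
Qed.

End integral_operator.

(** * Affine change of variables, dominated convergence, Scheffe's lemma *)

Section affine_substitution.
Context {R : realType}.
Local Notation mu := (@lebesgue_measure R).
Variables (s d c : R).
Hypothesis d0 : d != 0.
Hypothesis dc : `|d| = c.

Let phi : measurableTypeR R -> measurableTypeR R := fun y : R => s + d * y.

Let mphi : measurable_fun setT phi.
Proof. by apply: measurable_funD => //; exact: measurable_funM. Qed.

Let pushforward_phi : {measure set (measurableTypeR R) -> \bar R}.
Proof.
by unshelve refine (pushforward mu phi : {measure set _ -> \bar R}); exact: mphi.
Defined.

Let nu : {measure set (measurableTypeR R) -> \bar R} :=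
  mscale (NngNum (normr_ge0 d)) pushforward_phi.

Let lebesgue_measure_affine (X : set R) : measurable X ->
  mu X = nu X.
Proof.
apply: (@lebesgue_measure_unique _ nu) => _ [[a b] _ <-].
rewrite -[RHS]/(`|d|%:E * mu (phi @^-1` `]a, b]))%E.
(* A negative [d] reverses the half-open interval, so its preimage is closed on the left; the length
   is the same. *)
have [dgt0|dlt0|/eqP] := ltgtP d 0; last by rewrite (negbTE d0).
  have -> : phi @^-1` `]a, b] = `[(b - s) / d, (a - s) / d[%classic.
    apply/seteqP; split=> y; rewrite /= !in_itv/= /phi.
      by rewrite ltr_ndivlMr// ler_ndivrMr// ltrBlDl lerBrDl mulrC andbC.
    by rewrite ltr_ndivlMr// ler_ndivrMr// ltrBlDl lerBrDl mulrC andbC.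
  rewrite !lebesgue_measure_itv/= !lte_fin ltr_nM2r ?invr_lt0// ltrD2r.
  case: ifPn => _; last by rewrite mule0.
  by rewrite -!EFinB -EFinM ltr0_norm//; congr EFin; field.
have -> : phi @^-1` `]a, b] = `](a - s) / d, (b - s) / d]%classic.
  apply/seteqP; split=> y; rewrite /= !in_itv/= /phi.
    by rewrite ltr_pdivrMr// ler_pdivlMr// ltrBlDl lerBrDl mulrC.
  by rewrite ltr_pdivrMr// ler_pdivlMr// ltrBlDl lerBrDl mulrC.
rewrite !lebesgue_measure_itv/= !lte_fin ltr_pM2r ?invr_gt0// ltrD2r.
case: ifPn => _; last by rewrite mule0.
by rewrite -!EFinB -EFinM gtr0_norm//; congr EFin; field.
Qed.

Lemma ge0_integral_affine (D : set R) (f : R -> \bar R) :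
  measurable D -> measurable_fun D f -> (forall x, D x -> (0 <= f x)%E) ->
  (\int[mu]_(x in D) f x =
   c%:E * \int[mu]_(y in (fun y : R => s + d * y)%R @^-1` D) f (s + d * y)%R)%E.
Proof.
move=> mD mf f0.
rewrite (eq_measure_integral nu); last first.
  by move=> A mA AD; exact: lebesgue_measure_affine.
rewrite ge0_integral_mscale//=; congr (_ * _)%E; first by rewrite dc.
by rewrite ge0_integral_pushforward// => y /[!inE]; exact: f0.
Qed.

(** If the integral is infinite both sides are 0: the positive factor [c] preserves infinity, and
    [fine] sends it to 0. *)
Lemma Rintegral_affine (D : set R) (f : R -> R) :
  measurable D -> measurable_fun D f -> (forall x, D x -> 0 <= f x) ->
  \int[mu]_(x in D) f x = 
    c * \int[mu]_(y in (fun y : R => s + d * y) @^-1` D) f (s + d * y).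
Proof.
move=> mD mf f0; rewrite /Rintegral ge0_integral_affine//; last first.
  exact/measurable_EFinP.
case: (integral _ _ _) => [r||]//=.
  by rewrite gt0_muley ?lte_fin -?dc ?normr_gt0// mulr0.
by rewrite gt0_muleNy ?lte_fin -?dc ?normr_gt0// mulr0.
Qed.

End affine_substitution.

Section dominated_Rintegral.
Context d (X : measurableType d) (R : realType).
Variables (mu : {measure set X -> \bar R}) (D : set X) (mD : measurable D).

Lemma dominated_cvg_Rintegral (f_ : (X -> R)^nat) (f g : X -> R) :
  (forall n, measurable_fun D (f_ n)) -> measurable_fun D f ->
  {ae mu, forall x, D x -> f_ ^~ x @ \oo --> f x} ->
  mu.-integrable D (EFin \o g) ->
  (forall n x, D x -> `|f_ n x| <= g x) ->
  \int[mu]_(x in D) f_ n x @[n --> \oo] --> \int[mu]_(x in D) f x.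
Proof.
move=> mf_ mf f_f ig f_g.
have [||||if0 _ cf] := @dominated_convergence _ _ _ mu D mD
  (fun n => EFin \o f_ n) (EFin \o f) (EFin \o g) _ _ _ ig.
- by move=> n; exact/measurable_EFinP.
- exact/measurable_EFinP.
- by apply: filterS f_f => x fx Dx; apply: cvg_EFin; [exact: nearW|exact: fx].
- by apply: aeW => x n Dx; rewrite lee_fin; exact: f_g.
apply: fine_cvg; rewrite fineK; first exact: cf.
exact: integrable_fin_num.
Qed.

Lemma scheffe_Rintegral (f_ : (X -> R)^nat) (f : X -> R) :
  (forall n, mu.-integrable D (EFin \o f_ n)) ->
  mu.-integrable D (EFin \o f) ->
  (forall n x, D x -> 0 <= f_ n x) -> (forall x, D x -> 0 <= f x) ->
  {ae mu, forall x, D x -> f_ ^~ x @ \oo --> f x} ->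
  \int[mu]_(x in D) f_ n x @[n --> \oo] --> \int[mu]_(x in D) f x ->
  \int[mu]_(x in D) `|f_ n x - f x| @[n --> \oo] --> 0.
Proof.
move=> if_ jf f_0 f0 f_f cf.
have mf_ n : measurable_fun D (f_ n) by apply/measurable_EFinP/measurable_int/if_.
have mf : measurable_fun D f by apply/measurable_EFinP/measurable_int/jf.
(* The positive part of f - f_n. It is at most f because f_n >= 0, so it is dominated even when |f_n
   - f| is not, and |f_n - f| = (f_n - f) + 2 g_n. *)
pose g n x := 2^-1 * (`|f x - f_ n x| + (f x - f_ n x)).
have mg n : measurable_fun D (g n).
  apply: measurable_funM => //; apply: measurable_funD.
    by apply: measurableT_comp => //; exact: measurable_funB.
  exact: measurable_funB.
have gf n x : D x -> `|g n x| <= f x.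
  move=> Dx; have := f0 x Dx; have := f_0 n x Dx => fn0 fx0; rewrite /g.
  by rewrite ler_norml; case: (ger0P (f x - f_ n x)) => h; apply/andP; split; lra.
have ig n : mu.-integrable D (EFin \o g n).
  apply: (le_integrable mD _ _ jf); first exact/measurable_EFinP.
  by move=> x Dx /=; rewrite lee_fin (le_trans (gf n x Dx))// ler_norm.
have cg : \int[mu]_(x in D) g n x @[n --> \oo] --> \int[mu]_(x in D) (cst 0 x : R).
  apply: (@dominated_cvg_Rintegral g _ f) => //.
  apply: filterS f_f => x fx Dx.
  have -> : cst 0 x = 2^-1 * (`|f x - f x| + (f x - f x)).
    by rewrite subrr normr0 addr0 mulr0.
  have fB : f x - f_ n x @[n --> \oo] --> f x - f x.
    by apply: cvgB; [exact: cvg_cst|exact: fx].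
  by apply: cvgMr; apply: cvgD => //; exact: cvg_norm.
have -> : (fun n => \int[mu]_(x in D) `|f_ n x - f x|) = (fun n =>
    (\int[mu]_(x in D) f_ n x - \int[mu]_(x in D) f x) + 2 * \int[mu]_(x in D) g n x).
  apply/funext => n.
  rewrite -RintegralB// -RintegralZl// -RintegralD//; last 2 first.
  - exact: integrable_EFinB.
  - exact: integrable_EFinZl.
  apply: eq_Rintegral => x _; rewrite /g.
  by rewrite distrC; field.
have -> : (0 : R) = (\int[mu]_(x in D) f x - \int[mu]_(x in D) f x)
    + 2 * \int[mu]_(x in D) (cst 0 x : R).
  by rewrite subrr /Rintegral integral0 mulr0 addr0.
apply: cvgD; last by apply: cvgM => //; exact: cvg_cst.
by apply: cvgB => //; exact: cvg_cst.
Qed.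

End dominated_Rintegral.

(** * Integrability of power and beta weights *)

Section powR_integrable.
Context {R : realType}.
Local Notation mu := (@lebesgue_measure R).

Lemma powR_ndecr (x y e : R) : e <= 0 -> 0 < x -> x <= y -> y `^ e <= x `^ e.
Proof.
move=> e0 x0 xy; rewrite -(opprK e) !(powRN _ (- e)).
rewrite lef_pV2 ?posrE ?powR_gt0 ?(lt_le_trans x0)//.
by apply: ge0_ler_powR; rewrite ?oppr_ge0// nnegrE ltW// (lt_le_trans x0).
Qed.

Lemma integral_powR_itv (b x y : R) : 0 < b -> 0 < x -> x < y ->
  (\int[mu]_(t in `[x, y]) (t `^ (b - 1))%:E = ((y `^ b - x `^ b) / b)%:E)%E.
Proof.
move=> b0 x0 xy.
have dF (t : R) : 0 < t -> is_derive t 1 (fun t => b^-1 * t `^ b) (t `^ (b - 1)).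
  move=> t0; have := @is_deriveZ _ _ _ (@powR R ^~ b) b^-1 t 1 _ (is_derive1_powR b t0).
  by rewrite /GRing.scale/= mulrA mulVf ?mul1r//; exact: lt0r_neq0.
have cF t : 0 < t -> {for t, continuous (fun t => b^-1 * t `^ b)}.
  by move=> t0; apply/differentiable_continuous/derivable1_diffP; case: (dF t t0).
rewrite (@continuous_FTC2 _ _ (fun t => b^-1 * t `^ b))//.
- by rewrite -EFinB -mulrBr mulrC.
- apply: derivable_within_continuous => t; rewrite in_itv/= => /andP[xt _].
  by apply: derivable_powR; rewrite in_itv/= andbT (lt_le_trans x0).
- split=> /=.
  + by move=> t; rewrite in_itv/= => /andP[xt _]; case: (dF t (lt_trans x0 xt)).
  + exact/cvg_at_right_filter/cF.
  + by apply/cvg_at_left_filter/cF; exact: lt_trans xy.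
- move=> t; rewrite in_itv/= => /andP[xt _]; rewrite derive1E.
  by case: (dF t (lt_trans x0 xt)).
Qed.

Lemma integrable_powR (b c : R) : 0 < b ->
  mu.-integrable `]0, c[ (EFin \o (fun y => y `^ (b - 1))).
Proof.
move=> b0; have [c0|c0] := leP c 0.
  by rewrite set_itv_ge ?bnd_simp -?leNgt//; exact: integrable_set0.
apply/integrableP; split.
  apply/measurable_EFinP/measurable_funTS; exact: measurable_powR.
under eq_integral => y _ do rewrite /= ger0_norm ?powR_ge0//.
(* With [n.+2] the left end is strictly below [c] already at n = 0. The antiderivative bounds all
   these integrals by c^b / b. *)
pose F (n : nat) : set R := `[c / n.+2%:R, c]%classic.
have Fn : nondecreasing_seq F.
  move=> n m nm; rewrite subsetEset; apply: subset_itvr.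
  by rewrite bnd_simp ler_pM2l// lef_pV2 ?posrE// ler_nat.
apply: (@le_lt_trans _ _ (c `^ b / b)%:E); last exact: ltry.
apply: (@le_trans _ _ (\int[mu]_(y in \bigcup_i F i) (y `^ (b - 1))%:E)%E).
  apply: ge0_subset_integral => //.
  - by apply: bigcup_measurable => n _; exact: measurable_itv.
  - by apply/measurable_EFinP/measurable_funTS; exact: measurable_powR.
  - by move=> y _; rewrite lee_fin powR_ge0.
  - move=> y /=; rewrite in_itv/= => /andP[y0 yc].
    exists (Num.bound (c / y)) => //; rewrite /F /= in_itv/= (ltW yc) andbT.
    rewrite ler_pdivrMr// mulrC -ler_pdivrMr//.
    have h : c / y < (Num.bound (c / y))%:R.
      by apply: archi_boundP; rewrite divr_ge0 ?ltW.
    by apply: (le_trans (ltW h)); rewrite ler_nat -addn2 leq_addr.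
have cF : (\int[mu]_(x in F n) (x `^ (b - 1))%:E @[n --> \oo]
    --> \int[mu]_(x in \bigcup_i F i) (x `^ (b - 1))%:E)%E.
  apply: ge0_nondecreasing_set_cvg_integral => //.
  - by move=> n; exact: measurable_itv.
  - by move=> n; apply/measurable_EFinP/measurable_funTS; exact: measurable_powR.
  - by move=> n y _; rewrite lee_fin powR_ge0.
rewrite -(cvg_lim _ cF)//; apply: lime_le; first by apply/cvg_ex; eexists; exact: cF.
apply: nearW => n; rewrite integral_powR_itv ?divr_gt0//; last first.
  by rewrite ltr_pdivrMr// ltr_pMr// ltr1n.
by rewrite lee_fin ler_pM2r ?invr_gt0// gerBl powR_ge0.
Qed.

Lemma integrable_powR_onem (b : R) : 0 < b ->
  mu.-integrable `]0, 1[ (EFin \o (fun y => (1 - y) `^ (b - 1))).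
Proof.
move=> b0; have [mp bp] := integrableP _ _ _ (integrable_powR 1 b0).
have m1 : measurable_fun setT (fun y : R => (1 - y) `^ (b - 1)).
  apply: (measurableT_comp (measurable_powR (b - 1))).
  exact: measurable_funB.
apply/integrableP; split; first exact/measurable_EFinP/measurable_funTS.
have N10 : (-1 : R) != 0 by rewrite oppr_eq0 oner_eq0.
have mabs : measurable_fun (`]0, 1[%classic : set R) (fun y : R => `|(y `^ (b - 1))%:E|%E).
  exact: measurableT_comp.
have := ge0_integral_affine 1 N10 (normrN1 R) (measurable_itv _) mabs.
move=> /(_ (fun=> fun=> abse_ge0 _)); rewrite mul1e => affE.
rewrite (_ : _ @^-1` _ = `]0, 1[%classic) in affE; last first.
  by apply/seteqP; split=> y; rewrite /= !in_itv/= => /andP[? ?]; apply/andP; lra.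
apply: le_lt_trans bp; rewrite [leRHS]affE le_eqVlt; apply/orP; left; apply/eqP.
by apply: eq_integral => y _; rewrite mulN1r.
Qed.

Lemma integrable_beta (b c : R) : 0 < b <= 1 -> 0 < c <= 1 ->
  mu.-integrable `]0, 1[ (EFin \o (fun y => y `^ (b - 1) * (1 - y) `^ (c - 1))).
Proof.
move=> /andP[b0 b1] /andP[c0 c1].
have m1 (e : R) : measurable_fun setT (fun y : R => (1 - y) `^ e).
  by apply: (measurableT_comp (measurable_powR e)); exact: measurable_funB.
(* Both exponents are nonpositive, so on each half of the interval the factor regular there is at
   most its value at 1/2. *)
pose g y := 2^-1 `^ (c - 1) * y `^ (b - 1) + 2^-1 `^ (b - 1) * (1 - y) `^ (c - 1).
have ig : mu.-integrable `]0, 1[ (EFin \o g).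
  apply: integrable_EFinD => //; apply: integrable_EFinZl => //.
    exact: integrable_powR.
  exact: integrable_powR_onem.
apply: le_integrable ig => //.
  apply/measurable_EFinP/measurable_funTS; apply: measurable_funM => //.
  exact: m1.
move=> y; rewrite /= in_itv/= => /andP[y0 y1]; rewrite lee_fin.
rewrite !ger0_norm ?addr_ge0 ?mulr_ge0 ?powR_ge0// /g.
have [y2|y2] := leP y (2^-1).
  apply: (@le_trans _ _ (2^-1 `^ (c - 1) * y `^ (b - 1))).
    rewrite mulrC ler_wpM2r ?powR_ge0// powR_ndecr//; lra.
  by rewrite lerDl mulr_ge0 ?powR_ge0.
apply: (@le_trans _ _ (2^-1 `^ (b - 1) * (1 - y) `^ (c - 1))).
  rewrite ler_wpM2r ?powR_ge0// powR_ndecr//; lra.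
by rewrite lerDr mulr_ge0 ?powR_ge0.
Qed.

End powR_integrable.

(** * Averaging a family of L1 functions against an integrable weight *)

Section mixture.
Context {R : realType}.
Local Notation mu := (@lebesgue_measure R).
Local Notation RR := (measurableTypeR R * measurableTypeR R)%type.
Variables (c : R) (p : R -> R) (m : R -> R -> R).
Hypothesis p_ge0 : forall z, 0 <= p z.
Hypothesis p_itv : forall z, z \notin `[0, 1] -> p z = 0.
Hypothesis p_integrable : mu.-integrable setT (EFin \o p).
Hypothesis m_ge0 : forall s z, 0 <= m s z.
Hypothesis m_measurable : measurable_fun setT (fun x : RR => m x.1 x.2).
Hypothesis m_integrable : forall z, z \in `[0, 1] ->
  mu.-integrable setT (EFin \o m^~ z).
Hypothesis m_le : forall z, z \in `[0, 1] -> \int[mu]_s m s z <= c.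

Let k (x : RR) := (p x.2 * m x.1 x.2)%:E.

Let mk : measurable_fun setT k.
Proof.
apply/measurable_EFinP/measurable_funM => //.
apply: (measurableT_comp _ measurable_snd).
by apply/measurable_EFinP; exact: measurable_int p_integrable.
Qed.

Let k_ge0 x : (0 <= k x)%E. Proof. by rewrite lee_fin mulr_ge0. Qed.

Let int_k z : (\int[mu]_s k (s, z) = (p z * \int[mu]_s m s z)%:E)%E.
Proof.
have [zI|zI] := boolP (z \in `[0, 1]); last first.
  rewrite p_itv// mul0r; transitivity (\int[mu]_s (cst 0 s : \bar R))%E.
    by apply: eq_integral => s _; rewrite /k/= p_itv// mul0r.
  exact: integral0.
transitivity (\int[mu]_s ((p z)%:E * (m s z)%:E))%E.
  by apply: eq_integral => s _; rewrite -EFinM.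
rewrite integralZl//; last exact: m_integrable.
rewrite EFinM /Rintegral fineK//; apply: integrable_fin_num => //.
exact: m_integrable.
Qed.

Lemma mixture_le z : p z * \int[mu]_s m s z <= c * p z.
Proof.
have [zI|zI] := boolP (z \in `[0, 1]); last by rewrite p_itv// mul0r mulr0.
by rewrite mulrC ler_wpM2r// m_le.
Qed.

Let mixture_ge0 z : 0 <= p z * \int[mu]_s m s z.
Proof. by rewrite mulr_ge0//; exact: Rintegral_ge0. Qed.

Lemma measurable_mixture : measurable_fun setT (fun z => p z * \int[mu]_s m s z).
Proof.
apply/measurable_EFinP.
rewrite (_ : _ \o _ = fun z => \int[mu]_s k (s, z))%E; last first.
  by apply/funext => z; rewrite int_k.
exact: (measurable_fun_fubini_tonelli_G k mk k_ge0).
Qed.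

Lemma integrable_mixture :
  mu.-integrable setT (EFin \o (fun z => p z * \int[mu]_s m s z)).
Proof.
apply: (le_integrable _ _ _ (integrable_EFinZl c measurableT p_integrable)) => //.
  by apply/measurable_EFinP; exact: measurable_mixture.
move=> z _ /=; rewrite lee_fin ger0_norm//.
by rewrite (le_trans (mixture_le z))// ler_norm.
Qed.

(** The section serves twice: m(s, z) = M(s, u z) gives integrability of the averaged kernel, and
    m(s, z) = |M(s, u z) - M(s, u' z)| bounds its L1 modulus. *)
Lemma tonelli_mixture : (\int[mu]_s \int[mu]_z (p z * m s z)%:E =
  (\int[mu]_z (p z * \int[mu]_s m s z))%:E)%E.
Proof.
rewrite -[LHS]/(\int[mu]_s \int[mu]_z k (s, z))%E fubini_tonelli//.
under eq_integral do rewrite int_k.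
rewrite /Rintegral fineK//; apply: integrable_fin_num => //.
exact: integrable_mixture.
Qed.

Lemma integrable_prod_mixture :
  (mu \x mu)%E.-integrable setT (fun x : RR => (p x.2 * m x.1 x.2)%:E).
Proof.
apply/integrable12ltyP => //.
have -> : (\int[mu]_x \int[mu]_y `|k (x, y)|
    = \int[mu]_s \int[mu]_z (p z * m s z)%:E)%E.
  by apply: eq_integral => s _; apply: eq_integral => z _; rewrite gee0_abs.
by rewrite tonelli_mixture ltry.
Qed.

End mixture.

Section averaged_kernel.
Context {R : realType}.
Local Notation mu := (@lebesgue_measure R).
Variables (T C : R) (p : R -> R) (M : R -> R -> R).
Hypothesis p_ge0 : forall z, 0 <= p z.
Hypothesis p_itv : forall z, z \notin `[0, 1] -> p z = 0.
Hypothesis p_integrable : mu.-integrable setT (EFin \o p).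
Hypothesis M_ge0 : forall s v, 0 <= M s v.
Hypothesis M_measurable : measurable_fun setT
  (fun x : measurableTypeR R * measurableTypeR R => M x.1 x.2).
Hypothesis M_integrable : forall v, v \in `[0, T] ->
  mu.-integrable setT (EFin \o M^~ v).
Hypothesis M_le : forall v, v \in `[0, T] -> \int[mu]_s M s v <= C.
Hypothesis M_cvg : forall (v_ : nat -> R) v, (forall n, v_ n \in `[0, T]) ->
  v \in `[0, T] -> v_ n @[n --> \oo] --> v ->
  \int[mu]_s `|M s (v_ n) - M s v| @[n --> \oo] --> 0.

Definition averaged_kernel s u := \int[mu]_z (p z * M s (u * z)).
Local Notation kap := averaged_kernel.

Let mul_itv u z : u \in `[0, T] -> z \in `[0, 1] -> u * z \in `[0, T].
Proof.
rewrite !in_itv/= => /andP[u0 uT] /andP[z0 z1].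
by rewrite mulr_ge0//= (le_trans _ uT)// ler_piMr.
Qed.

Let mM u : measurable_fun setT
  (fun x : measurableTypeR R * measurableTypeR R => M x.1 (u * x.2)).
Proof.
have mm : measurable_fun setT
    (fun x : measurableTypeR R * measurableTypeR R => (x.1, u * x.2 : measurableTypeR R)).
  apply: measurable_fun_pair => //=.
  by apply: measurable_funM => //; exact: measurable_snd.
exact: (measurableT_comp M_measurable mm).
Qed.

Let h_integrable u : u \in `[0, T] -> (mu \x mu)%E.-integrable setT
  (fun x : measurableTypeR R * measurableTypeR R => (p x.2 * M x.1 (u * x.2))%:E).
Proof.
move=> uT; apply: (@integrable_prod_mixture _ C p (fun s z => M s (u * z))) => //.
- by move=> z zI; exact/M_integrable/mul_itv.
- by move=> z zI; exact/M_le/mul_itv.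
Qed.

Lemma averaged_kernel_integrable u : u \in `[0, T] ->
  mu.-integrable setT (EFin \o kap^~ u).
Proof.
move=> uT; have iF := integrable_fubini_F (h_integrable uT).
apply: (le_integrable _ _ _ iF) => //.
  apply/measurable_EFinP; apply: (measurableT_comp (fine_measurable measurableT)) => //.
  exact: (measurable_int mu iF).
(* Where the inner integral is infinite [fine] returns 0, so the bound persists. *)
move=> s _; rewrite /kap /Rintegral /fubini_F /=.
by case: (integral _ _ _) => [r||]//=; rewrite normr0 leey.
Qed.

Section distance.
Variables (u u' : R) (uT : u \in `[0, T]) (u'T : u' \in `[0, T]).

Let m s z := `|M s (u * z) - M s (u' * z)|.

Let m_ge0 s z : 0 <= m s z. Proof. exact: normr_ge0. Qed.

Let mm : measurable_fun setT
  (fun x : measurableTypeR R * measurableTypeR R => m x.1 x.2).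
Proof. by apply: measurableT_comp => //; exact: measurable_funB. Qed.

Let im z : z \in `[0, 1] -> mu.-integrable setT (EFin \o m^~ z).
Proof.
move=> zI; have i1 := M_integrable (mul_itv uT zI).
have i2 := M_integrable (mul_itv u'T zI).
exact: (integrable_norm (integrable_EFinB measurableT i1 i2)).
Qed.

Let m_le z : z \in `[0, 1] -> \int[mu]_s m s z <= 2 * C.
Proof.
move=> zI; have i1 := M_integrable (mul_itv uT zI).
have i2 := M_integrable (mul_itv u'T zI).
apply: (@le_trans _ _ (\int[mu]_s (M s (u * z) + M s (u' * z)))).
  apply: le_Rintegral => //; first exact: im.
    exact: integrable_EFinD.
  by move=> s _; rewrite (le_trans (ler_normB _ _))// !ger0_norm.
by rewrite RintegralD// mulr_natl mulr2n lerD// M_le// mul_itv.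
Qed.

Let D z := p z * \int[mu]_s m s z.

Lemma averaged_kernel_dist_le z : D z <= 2 * C * p z.
Proof. exact: mixture_le. Qed.

Lemma averaged_kernel_dist_measurable : measurable_fun setT D.
Proof. exact: measurable_mixture. Qed.

Lemma averaged_kernel_dist :
  \int[mu]_s `|kap s u - kap s u'| <= \int[mu]_z D z.
Proof.
have ik : mu.-integrable setT (EFin \o (fun s => `|kap s u - kap s u'|)).
  exact: (integrable_norm (integrable_EFinB measurableT
    (averaged_kernel_integrable uT) (averaged_kernel_integrable u'T))).
rewrite -lee_fin -(@tonelli_mixture _ (2 * C))// /Rintegral fineK; last first.
  exact: integrable_fin_num.
have mF : measurable_fun setT (fun s => \int[mu]_z (p z * m s z)%:E)%E.
  apply: (@measurable_fun_fubini_tonelli_F _ _ _ _ _ mu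
    (fun x : measurableTypeR R * measurableTypeR R => (p x.2 * m x.1 x.2)%:E)).
    exact: measurable_int (integrable_prod_mixture _ _ _ _ _ im m_le).
  by move=> x; rewrite lee_fin mulr_ge0.
apply: ae_ge0_le_integral => //.
- exact: measurable_int ik.
- by move=> s _; apply: integral_ge0 => z _; rewrite lee_fin mulr_ge0.
(* By Fubini both z-integrals converge for almost every s, and only there can the difference be
   moved under the integral. *)
have := ae_integrable1 (h_integrable u'T); have := ae_integrable1 (h_integrable uT).
move=> ae ae'; apply: filterS2 ae ae' => s i i' _ /=.
rewrite /kap -RintegralB//.
apply: (@le_trans _ _ (\int[mu]_z `|p z * M s (u * z) - p z * M s (u' * z)|)%:E).
  by rewrite lee_fin le_normr_Rintegral//; exact: integrable_EFinB.
rewrite /Rintegral fineK; last first.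
  apply: integrable_fin_num => //.
  exact: (integrable_norm (integrable_EFinB measurableT i i')).
rewrite le_eqVlt; apply/orP; left; apply/eqP; apply: eq_integral => z _.
by rewrite -mulrBr normrM (ger0_norm (p_ge0 z)).
Qed.

End distance.

(** For each z the L1 distance of the sections tends to 0 by [M_cvg]; weighted by p z it is at most
    2 C p z, so dominated convergence in z applies. *)
Lemma averaged_kernel_cvg (u_ : nat -> R) u : (forall n, u_ n \in `[0, T]) ->
  u \in `[0, T] -> u_ n @[n --> \oo] --> u ->
  \int[mu]_s `|kap s (u_ n) - kap s u| @[n --> \oo] --> 0.
Proof.
move=> u_T uT u_u.
pose D n z := p z * \int[mu]_s `|M s (u_ n * z) - M s (u * z)|.
have D0 : \int[mu]_z D n z @[n --> \oo] --> \int[mu]_z (cst 0 z : R).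
  apply: (@dominated_cvg_Rintegral _ _ _ mu _ measurableT _ _ (fun z => 2 * C * p z)) => //.
  - by move=> n; exact: averaged_kernel_dist_measurable.
  - apply: aeW => z _; have [zI|zI] := boolP (z \in `[0, 1]); last first.
      rewrite (_ : (fun n => _) = cst 0); first exact: cvg_cst.
      by apply/funext => n; rewrite /D p_itv// mul0r.
    rewrite (_ : cst 0 z = p z * 0); last by rewrite mulr0.
    apply: cvgMr; apply: M_cvg; [by move=> n; exact: mul_itv|exact: mul_itv|].
    by apply: cvgMl.
  - exact: integrable_EFinZl.
  - move=> n z _; rewrite ger0_norm ?averaged_kernel_dist_le//.
    by apply: mulr_ge0 => //; exact: Rintegral_ge0.
rewrite {2}/Rintegral integral0/= in D0.
apply: (squeeze_cvgr _ (cvg_cst 0) D0).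
by apply: nearW => n; rewrite averaged_kernel_dist// andbT; exact: Rintegral_ge0.
Qed.

End averaged_kernel.

(** * The bounded factor N *)

Lemma powR_cvg (R : realType) (x_ : nat -> R) (x e : R) : 0 < x -> x_ n @[n --> \oo] --> x ->
  x_ n `^ e @[n --> \oo] --> x `^ e.
Proof.
move=> x0 xx; apply: (cvg_comp x_ (@powR R ^~ e) xx).
suff : {for x, continuous (@powR R ^~ e)} by [].
apply/differentiable_continuous/derivable1_diffP.
by apply: derivable_powR; rewrite in_itv/= andbT.
Qed.

Section singular_kernel.
Context {R : realType}.
Local Notation mu := (@lebesgue_measure R).
Local Notation RR := (measurableTypeR R * measurableTypeR R)%type.
Variables (a : R) (w : R -> R).
Hypothesis a0 : 0 < a.
Hypothesis w_ge0 : forall y, 0 <= w y.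
Hypothesis w_itv : forall y, y \notin `]0, 1[ -> w y = 0.
Hypothesis w_integrable : mu.-integrable setT (EFin \o w).

(* With w y = (1 - y)^(1/2 - H1) y^(H2 - 3/2) on ]0, 1[ and q = s + (t - s) y,
   this is w q^(a - 1) (q + (t - s) y): the derivative in t of
   (t - s)^a w q^a, divided by a (t - s)^(a - 1). *)
Definition kerN_integrand t s y :=
  w y * ((s + (t - s) * y) `^ (a - 1) * `|s + 2 * (t - s) * y|).

Definition kerN t s := \int[mu]_y kerN_integrand t s y.

Let measurable_w : measurable_fun setT w.
Proof. by apply/measurable_EFinP; exact: measurable_int w_integrable. Qed.

(** The absolute value in the integrand makes this true for all arguments, so that Tonelli gives
    measurability of [kerN] on the whole plane. *)
Let kerN_integrand_ge0 t s y : 0 <= kerN_integrand t s y.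
Proof. by rewrite !mulr_ge0 ?powR_ge0. Qed.

Lemma kerN_ge0 t s : 0 <= kerN t s.
Proof. exact: Rintegral_ge0. Qed.

(** With q = s + (t - s) y the last factor is at most 2 q, which restores the power missing in q^(a
    - 1) and leaves 2 q^a. The bound is therefore uniform down to s = 0. *)
Lemma kerN_integrand_le t s y c : 0 <= s -> s <= t -> 0 < t -> t <= c ->
  kerN_integrand t s y <= 2 * c `^ a * w y.
Proof.
move=> s0 st t0 tc; rewrite /kerN_integrand.
have [yI|yI] := boolP (y \in `]0, 1[); last by rewrite w_itv// mul0r mulr0.
move: yI; rewrite in_itv/= => /andP[y0 y1].
rewrite mulrC ler_wpM2r//.
have ty0 : 0 <= (t - s) * y by rewrite mulr_ge0 ?subr_ge0// ltW.
have tyt : (t - s) * y <= t - s by rewrite ler_piMr ?subr_ge0// ltW.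
set q := s + (t - s) * y.
have q0 : 0 <= q by rewrite addr_ge0.
have qc : q <= c by rewrite /q; lra.
have h : `|s + 2 * (t - s) * y| <= 2 * q.
  by rewrite -mulrA ger0_norm /q; lra.
apply: (@le_trans _ _ (q `^ (a - 1) * (2 * q))); first by rewrite ler_wpM2l ?powR_ge0.
rewrite mulrCA (mulrC _ q) mulr_powRB1// ler_wpM2l//.
have c0 : 0 <= c by exact: le_trans qc.
by apply: ge0_ler_powR; rewrite ?nnegrE// ltW.
Qed.

Let measurable_kerN_integrand : measurable_fun setT
  (fun x : RR * measurableTypeR R => kerN_integrand x.1.1 x.1.2 x.2).
Proof.
have m11 : measurable_fun setT (fun x : RR * measurableTypeR R => x.1.1).
  exact: (measurableT_comp measurable_fst measurable_fst).
have m12 : measurable_fun setT (fun x : RR * measurableTypeR R => x.1.2).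
  exact: (measurableT_comp measurable_snd measurable_fst).
have m2 : measurable_fun setT (fun x : RR * measurableTypeR R => x.2).
  exact: measurable_snd.
apply: measurable_funM; first exact: (measurableT_comp measurable_w).
apply: measurable_funM.
  apply: (measurableT_comp (measurable_powR (a - 1))).
  apply: measurable_funD => //; apply: measurable_funM => //.
  exact: measurable_funB.
apply: measurableT_comp => //.
apply: measurable_funD => //; apply: measurable_funM => //.
by apply: measurable_funM => //; exact: measurable_funB.
Qed.

Lemma measurable_kerN : measurable_fun setT (fun x : RR => kerN x.1 x.2).
Proof.
apply: (measurableT_comp (fine_measurable measurableT)) => //.
apply: (@measurable_fun_fubini_tonelli_F _ _ _ _ _ mu
  (fun x : RR * measurableTypeR R => (kerN_integrand x.1.1 x.1.2 x.2)%:E)).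
  exact/measurable_EFinP.
by move=> x; rewrite lee_fin.
Qed.

Let measurable_kerN_section t s : measurable_fun setT (kerN_integrand t s).
Proof.
exact: (measurableT_comp measurable_kerN_integrand (pair1_measurable (t, s))).
Qed.

Lemma kerN_integrable t s : 0 <= s -> s <= t -> 0 < t ->
  mu.-integrable setT (EFin \o kerN_integrand t s).
Proof.
move=> s0 st t0.
apply: (le_integrable _ _ _ (integrable_EFinZl (2 * t `^ a) measurableT w_integrable)) => //.
  by apply/measurable_EFinP; exact: measurable_kerN_section.
move=> y _; rewrite /= lee_fin ger0_norm//.
by rewrite (le_trans (kerN_integrand_le y s0 st t0 (lexx t)))// ler_norm.
Qed.

Lemma kerN_le t s c : 0 <= s -> s <= t -> 0 < t -> t <= c ->
  kerN t s <= 2 * c `^ a * \int[mu]_y w y.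
Proof.
move=> s0 st t0 tc; rewrite -RintegralZl//; apply: le_Rintegral => //.
- exact: kerN_integrable.
- exact: integrable_EFinZl.
- by move=> y _; exact: kerN_integrand_le.
Qed.

Lemma kerN_cvg (t_ s_ : nat -> R) (t s c : R) :
  (forall n, [/\ 0 <= s_ n, s_ n <= t_ n, 0 < t_ n & t_ n <= c]) ->
  0 <= s -> s <= t -> 0 < t ->
  t_ n @[n --> \oo] --> t -> s_ n @[n --> \oo] --> s ->
  kerN (t_ n) (s_ n) @[n --> \oo] --> kerN t s.
Proof.
move=> ts_ s0 st t0 tt ss.
apply: (@dominated_cvg_Rintegral _ _ _ mu _ measurableT
  (fun n => kerN_integrand (t_ n) (s_ n)) _ (fun y => 2 * c `^ a * w y)) => //.
- by move=> n; exact: measurable_kerN_section.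
- exact: measurable_kerN_section.
- apply: aeW => y _; rewrite /kerN_integrand.
  have [yI|yI] := boolP (y \in `]0, 1[); last first.
    rewrite (_ : (fun n => _) = cst 0); first by rewrite w_itv// mul0r; exact: cvg_cst.
    by apply/funext => n; rewrite w_itv// mul0r.
  move: yI; rewrite in_itv/= => /andP[y0 y1].
  have cts : t_ n - s_ n @[n --> \oo] --> t - s by exact: cvgB.
  apply: cvgMr; apply: cvgM.
    apply: powR_cvg; last by apply: cvgD => //; exact: cvgMl.
    (* In this form the base is visibly positive even at s = 0, so the power is continuous there. *)
    have -> : s + (t - s) * y = s * (1 - y) + t * y by ring.
    by rewrite ltr_wpDl ?mulr_ge0 ?mulr_gt0// subr_ge0 ltW.
  apply: cvg_norm; apply: cvgD => //; apply: cvgMl.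
  exact: cvgMr.
- exact: integrable_EFinZl.
- move=> n y _; have [sn0 snt tn0 tnc] := ts_ n.
  by rewrite ger0_norm// kerN_integrand_le.
Qed.

End singular_kernel.

(** * The weakly singular kernel M and its continuity into L1 *)

Lemma integrable_EFin_patch d (X : measurableType d) (R : realType)
    (mu : {measure set X -> \bar R}) (D : set X) (f : X -> R) :
  measurable D -> mu.-integrable D (EFin \o f) ->
  mu.-integrable setT (EFin \o (f \_ D)).
Proof. by move=> mD ig; rewrite -restrict_EFin; apply/(integrable_mkcond _ mD). Qed.

Section truncated_singular_kernel.
Context {R : realType}.
Local Notation mu := (@lebesgue_measure R).
Local Notation RR := (measurableTypeR R * measurableTypeR R)%type.
Variables (a T : R) (w : R -> R).
Hypothesis a0 : 0 < a.
Hypothesis w_ge0 : forall y, 0 <= w y.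
Hypothesis w_itv : forall y, y \notin `]0, 1[ -> w y = 0.
Hypothesis w_integrable : mu.-integrable setT (EFin \o w).
Local Notation N := (kerN a w).

(** Cutting off at T inside the kernel allows integration over the whole line, a domain that the
    translation s = v + r leaves unchanged. *)
Definition kerM s v :=
  if (v < s) && (s <= T) then (s - v) `^ (a - 1) * N s v else 0.

Lemma kerM_ge0 s v : 0 <= kerM s v.
Proof.
rewrite /kerM; case: ifP => // _.
by apply: mulr_ge0; [exact: powR_ge0|exact: kerN_ge0].
Qed.

Lemma measurable_kerM : measurable_fun setT (fun x : RR => kerM x.1 x.2).
Proof.
have m1 : measurable_fun setT (fun x : RR => x.1) by exact: measurable_fst.
have m2 : measurable_fun setT (fun x : RR => x.2) by exact: measurable_snd.
apply: measurable_fun_ifT => //.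
- apply: measurable_and; first exact: measurable_fun_ltr.
  exact: measurable_fun_ler.
- apply: measurable_funM; last exact: measurable_kerN.
  apply: (measurableT_comp (measurable_powR (a - 1))).
  exact: measurable_funB.
Qed.

Let measurable_section v : measurable_fun setT (kerM ^~ v).
Proof. exact: (measurableT_comp measurable_kerM (pair2_measurable v)). Qed.

Let c := 2 * T `^ a * \int[mu]_y w y.

(** Majorant of the translated kernels for all v >= 0. The length [T + 1] keeps r = T, which occurs
    for v = 0, inside the open interval. *)
Let g : R -> R := (fun r => c * r `^ (a - 1)) \_ `]0, T + 1[.

Let g_integrable : mu.-integrable setT (EFin \o g).
Proof.
apply: integrable_EFin_patch => //; apply: integrable_EFinZl => //.
exact: integrable_powR.
Qed.

Let c_ge0 : 0 <= c.
Proof. by rewrite !mulr_ge0 ?powR_ge0//; exact: Rintegral_ge0. Qed.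

Let g_ge0 r : 0 <= g r.
Proof. by rewrite /g patchE; case: ifP => // _; rewrite mulr_ge0 ?powR_ge0. Qed.

Let kerM_shift v r :
  kerM (v + r) v = if (0 < r) && (r <= T - v) then r `^ (a - 1) * N (v + r) v else 0.
Proof. by rewrite /kerM ltrDl addrAC subrr add0r lerBrDl. Qed.

Let kerM_shift_le v r : 0 <= v -> kerM (v + r) v <= g r.
Proof.
move=> v0; rewrite kerM_shift; case: ifPn => [/andP[r0 rT]|_]; last exact: g_ge0.
rewrite /g patchE mem_set; last by rewrite /= in_itv/= r0/=; lra.
by rewrite mulrC ler_wpM2r ?powR_ge0// kerN_le//; lra.
Qed.

Let measurable_shift (v : R) : measurable_fun setT (fun r : R => kerM (v + r) v).
Proof.
apply: (measurableT_comp (measurable_section v)).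
by apply: measurable_funD.
Qed.

Let kerM_shift_integrable (v : R) : 0 <= v ->
  mu.-integrable setT (EFin \o (fun r : R => kerM (v + r) v)).
Proof.
move=> v0; apply: (le_integrable _ _ _ g_integrable) => //.
  by apply/measurable_EFinP; exact: measurable_shift.
move=> r _; rewrite /= lee_fin !ger0_norm ?kerM_ge0//; exact: kerM_shift_le.
Qed.

Lemma kerM_integrable v : 0 <= v -> mu.-integrable setT (EFin \o kerM ^~ v).
Proof.
move=> v0; have /integrableP[_ h] := kerM_shift_integrable v0.
apply/integrableP; split; first by apply/measurable_EFinP; exact: measurable_section.
apply: le_lt_trans h.
rewrite (ge0_integral_affine v (oner_neq0 R) (normr1 R) measurableT); last 2 first.
- by apply: measurableT_comp => //; apply/measurable_EFinP; exact: measurable_section.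
- by [].
rewrite mul1e preimage_setT le_eqVlt; apply/orP; left; apply/eqP.
by apply: eq_integral => r _; rewrite mul1r.
Qed.

Let Rintegral_kerM v : \int[mu]_s kerM s v = \int[mu]_r kerM (v + r) v.
Proof.
rewrite (Rintegral_affine v (oner_neq0 R) (normr1 R) measurableT); last 2 first.
- exact: measurable_section.
- by move=> s _; exact: kerM_ge0.
by rewrite mul1r preimage_setT; apply: eq_Rintegral => r _; rewrite mul1r.
Qed.

Lemma kerM_le v : 0 <= v -> \int[mu]_s kerM s v <= \int[mu]_r g r.
Proof.
move=> v0; rewrite Rintegral_kerM; apply: le_Rintegral => //.
  exact: kerM_shift_integrable.
by move=> r _; exact: kerM_shift_le.
Qed.

Let ae_neq (x : R) (P : R -> Prop) :
  (forall y, y != x -> P y) -> {ae mu, forall y, P y}.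
Proof.
move=> xP; exists [set x]; split => //; first exact: lebesgue_measure_set1.
by move=> y /= nPy; apply: contrapT => /eqP yx; apply: nPy; exact: xP.
Qed.

Let kerM_cvg_pointwise (v_ : nat -> R) (v s : R) : (forall n, v_ n \in `[0, T]) ->
  v \in `[0, T] -> v_ n @[n --> \oo] --> v -> s != v ->
  kerM s (v_ n) @[n --> \oo] --> kerM s v.
Proof.
move=> v_T vT vv sv; have v0 : 0 <= v by move: vT; rewrite in_itv/= => /andP[].
have v_0 n : 0 <= v_ n by have := v_T n; rewrite in_itv/= => /andP[].
rewrite /kerM; have [sT|sT] := leP s T; last first.
  by under eq_fun do rewrite andbF; rewrite andbF; exact: cvg_cst.
under eq_fun do rewrite andbT; rewrite andbT.
have [vs|sv'|/eqP] := ltgtP v s; last by rewrite eq_sym (negbTE sv).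
(* The minimum with [s] satisfies the order constraint of [kerN_cvg] for every n and changes only
   finitely many terms. *)
- apply: (@cvg_trans _ ((s - v_ n) `^ (a - 1) * N s (Num.min (v_ n) s) @[n --> \oo])).
    apply: near_eq_cvg; near=> n.
    have vns : v_ n < s by near: n; exact: (cvgr_lt v).
    by rewrite vns min_l// ltW.
  apply: cvgM.
    by apply: powR_cvg; [rewrite subr_gt0|apply: cvgB => //; exact: cvg_cst].
  apply: (@kerN_cvg _ a w a0 w_ge0 w_itv w_integrable (fun=> s)
    (fun n => Num.min (v_ n) s) s v s).
  + by move=> n; rewrite le_min ge_min lexx orbT v_0 ltW// (le_lt_trans v0).
  + exact: v0.
  + exact: ltW.
  + exact: le_lt_trans vs.
  + exact: cvg_cst.
  + apply: (cvg_trans _ vv); apply: near_eq_cvg; near=> n.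
    by rewrite min_l// ltW//; near: n; exact: (cvgr_lt v).
- apply: (@cvg_trans _ ((cst 0 : nat -> R) n @[n --> \oo])); last exact: cvg_cst.
  apply: near_eq_cvg; near=> n.
  have svn : s < v_ n by near: n; exact: (cvgr_gt v).
  by rewrite ltNge (ltW svn).
Unshelve. all: by end_near. Qed.

Let kerM_shift_cvg (v_ : nat -> R) (v : R) : (forall n, v_ n \in `[0, T]) ->
  v \in `[0, T] -> v_ n @[n --> \oo] --> v ->
  \int[mu]_s kerM s (v_ n) @[n --> \oo] --> \int[mu]_s kerM s v.
Proof.
move=> v_T vT vv; rewrite Rintegral_kerM; under eq_fun do rewrite Rintegral_kerM.
have v0 : 0 <= v by move: vT; rewrite in_itv/= => /andP[].
have v_0 n : 0 <= v_ n by have := v_T n; rewrite in_itv/= => /andP[].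
apply: (@dominated_cvg_Rintegral _ _ _ mu _ measurableT
  (fun n r => kerM (v_ n + r) (v_ n)) _ g) => //.
- by move=> n; exact: measurable_shift.
- exact: measurable_shift.
(* In the variable r the indicator v < s no longer moves; only the cut-off at T does, and its jump
   is at r = T - v. *)
- apply: (@ae_neq (T - v)) => r rT _.
  under eq_fun do rewrite kerM_shift; rewrite kerM_shift.
  have [r0|r0] := ltP 0 r; last exact: cvg_cst.
  have [rlt|rgt|/eqP] := ltgtP r (T - v); last by rewrite (negbTE rT).
  + apply: (@cvg_trans _ (r `^ (a - 1) * N (v_ n + r) (v_ n) @[n --> \oo])).
      apply: near_eq_cvg; near=> n.
      have h : v_ n < T - r by near: n; apply: (cvgr_lt v) => //; lra.
      by rewrite /= ifT//; lra.
    apply: cvgMr.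
    apply: (@kerN_cvg _ a w a0 w_ge0 w_itv w_integrable (fun n => v_ n + r) v_ _ _ (T + r)) => //.
    * move=> n; have := v_T n; rewrite in_itv/= => /andP[? ?]; split; lra.
    * lra.
    * lra.
    * by apply: cvgD => //; exact: cvg_cst.
  + apply: (@cvg_trans _ ((cst 0 : nat -> R) n @[n --> \oo])); last exact: cvg_cst.
    apply: near_eq_cvg; near=> n.
    have h : T - r < v_ n by near: n; apply: (cvgr_gt v) => //; lra.
    by rewrite /= ifF//; lra.
- by move=> n r _; rewrite ger0_norm ?kerM_ge0//; exact: kerM_shift_le.
Unshelve. all: by end_near. Qed.

Lemma kerM_cvg (v_ : nat -> R) (v : R) : (forall n, v_ n \in `[0, T]) ->
  v \in `[0, T] -> v_ n @[n --> \oo] --> v ->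
  \int[mu]_s `|kerM s (v_ n) - kerM s v| @[n --> \oo] --> 0.
Proof.
move=> v_T vT vv.
apply: scheffe_Rintegral => //.
- by move=> n; apply: kerM_integrable; have := v_T n; rewrite in_itv/= => /andP[].
- by apply: kerM_integrable; move: vT; rewrite in_itv/= => /andP[].
- by move=> n s _; exact: kerM_ge0.
- by move=> s _; exact: kerM_ge0.
- apply: (@ae_neq v) => s sv _; exact: kerM_cvg_pointwise.
- exact: kerM_shift_cvg.
Qed.

End truncated_singular_kernel.

(** * Differentiating the Volterra kernel K in its first argument *)

Section volterra_kernel_derivative.
Context {R : realType}.
Local Notation mu := (@lebesgue_measure R).
Variables (H1 H2 : R).
Hypothesis hH1 : 1 / 2 <= H1.
Hypothesis hH12 : H1 < H2.
Hypothesis hH2 : H2 < 1.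

Definition volterra_weight : R -> R :=
  (fun y : R => y `^ (H2 - 3 / 2) * (1 - y) `^ (1 / 2 - H1)) \_ `]0, 1[.
Local Notation w := volterra_weight.
Local Notation a := (H2 - H1).

Lemma volterra_weight_ge0 y : 0 <= w y.
Proof. by rewrite /w patchE; case: ifP => // _; rewrite mulr_ge0 ?powR_ge0. Qed.

Lemma volterra_weight_itv y : y \notin `]0, 1[ -> w y = 0.
Proof.
by move=> yI; rewrite /w patchE ifF//; apply: contraNF yI => /set_mem.
Qed.

Lemma volterra_weight_integrable : mu.-integrable setT (EFin \o w).
Proof.
apply: integrable_EFin_patch => //.
(* A beta weight with parameters H2 - 1/2 and 3/2 - H1, both in ]0, 1]. *)
have -> : H2 - 3 / 2 = (H2 - 1 / 2) - 1 by field.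
have -> : 1 / 2 - H1 = (3 / 2 - H1) - 1 by field.
by move: hH1 hH12 hH2 => *; apply: integrable_beta; apply/andP; split; lra.
Qed.

Let mw : measurable_fun setT w.
Proof. by apply/measurable_EFinP; exact: measurable_int volterra_weight_integrable. Qed.

Let mq (s t e : R) : measurable_fun setT (fun y : R => (s + (t - s) * y) `^ e).
Proof.
apply: (measurableT_comp (measurable_powR e)).
by apply: measurable_funD => //; exact: measurable_funM.
Qed.

Let q_itv (s t y : R) : s <= t -> y \in `]0, 1[ -> s <= s + (t - s) * y <= t.
Proof.
move=> st; rewrite in_itv/= => /andP[y0 y1].
have h0 : 0 <= (t - s) * y by rewrite mulr_ge0 ?subr_ge0// ltW.
have h1 : (t - s) * y <= t - s by rewrite ler_piMr ?subr_ge0// ltW.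
by apply/andP; split; lra.
Qed.

Let a_gt0 : 0 < a. Proof. by rewrite subr_gt0. Qed.

Let a_le1 : a - 1 <= 0. Proof. by move: hH1 hH2 => *; lra. Qed.

Let integrable_wq (s t : R) : 0 <= s -> s <= t ->
  mu.-integrable setT (EFin \o (fun y => w y * (s + (t - s) * y) `^ a)).
Proof.
move=> s0 st.
apply: (le_integrable _ _ _
  (integrable_EFinZl (t `^ a) measurableT volterra_weight_integrable)) => //.
  by apply/measurable_EFinP; apply: measurable_funM; [exact: mw|exact: mq].
move=> y _; rewrite /= lee_fin !ger0_norm ?mulr_ge0 ?powR_ge0 ?volterra_weight_ge0//.
have [yI|yI] := boolP (y \in `]0, 1[); last by rewrite volterra_weight_itv// mul0r mulr0.
have /andP[sq qt] := q_itv st yI.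
rewrite mulrC ler_wpM2r ?volterra_weight_ge0//.
by apply: ge0_ler_powR; rewrite ?nnegrE ?(ltW a_gt0)//; lra.
Qed.

(** Under u = s + (t - s) y the factors t - u and u - s contribute (t - s)^(a - 1) together, and the
    Jacobian raises the exponent to a. *)
Lemma K_volterra_weight (s t : R) : 0 < s -> s < t ->
  K H1 H2 t s = beta_coef H2 * s `^ (1 / 2 - H2) *
    ((t - s) `^ a * \int[mu]_y (w y * (s + (t - s) * y) `^ a)).
Proof.
move=> s0 st; rewrite /K; congr (_ * _).
have ts0 : 0 < t - s by rewrite subr_gt0.
pose f u := (t - u) `^ (1 / 2 - H1) * u `^ a * (u - s) `^ (H2 - 3 / 2).
rewrite -[X in X = _]/(\int[mu]_(u in `[s, t]) f u).
have mf : measurable_fun setT f.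
  apply: measurable_funM; [apply: measurable_funM|].
  - by apply: (measurableT_comp (measurable_powR _)); exact: measurable_funB.
  - exact: measurable_powR.
  - by apply: (measurableT_comp (measurable_powR _)); exact: measurable_funB.
rewrite (Rintegral_affine s (lt0r_neq0 ts0) (gtr0_norm ts0) (measurable_itv _)); last 2 first.
- exact: measurable_funTS.
- by move=> u _; rewrite !mulr_ge0 ?powR_ge0.
have -> : (fun y : R => s + (t - s) * y) @^-1` `[s, t] = `[0, 1]%classic.
  by apply/seteqP; split => y; rewrite /= !in_itv/= lerDl pmulr_rge0// -lerBrDl ger_pMr.
have -> : \int[mu]_(y in `[0, 1]) f (s + (t - s) * y) =
    \int[mu]_(y in `]0, 1[) f (s + (t - s) * y).
  rewrite /Rintegral (@integral_itv_bndoo _ 0 1 _ true false)//.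
  apply/measurable_EFinP/measurable_funTS/(measurableT_comp mf).
  by apply: measurable_funD => //; exact: measurable_funM.
rewrite Rintegral_mkcond.
transitivity ((t - s) * \int[mu]_y ((t - s) `^ (a - 1) *
    (w y * (s + (t - s) * y) `^ a))).
  congr (_ * _); apply: eq_Rintegral => y _; rewrite patchE /w [in RHS]patchE.
  case: ifPn => [|_]; last by rewrite mul0r mulr0.
  rewrite inE/= in_itv/= => /andP[y0 y1]; rewrite /f.
  have -> : t - (s + (t - s) * y) = (t - s) * (1 - y) by ring.
  have -> : s + (t - s) * y - s = (t - s) * y by ring.
  rewrite !powRM ?(ltW ts0) ?(ltW y0)//; last by rewrite subr_ge0 ltW.
  have -> : a - 1 = (1 / 2 - H1) + (H2 - 3 / 2) by field.
  rewrite (@powRD _ (t - s) (1 / 2 - H1)); last by rewrite (lt0r_neq0 ts0) implybT.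
  by ring.
rewrite RintegralZl//; last by apply: integrable_wq; exact: ltW.
by rewrite mulrA mulr_powRB1// ltW.
Qed.

Let q_gt0 (s x y : R) : 0 < s -> s < x -> y \in `]0, 1[ -> 0 < s + (x - s) * y.
Proof. by move=> s0 sx /(q_itv (ltW sx))/andP[sq _]; exact: lt_le_trans sq. Qed.

Let is_derive_integrand (s x y : R) : 0 < s -> s < x ->
  is_derive x 1 (fun x => w y * (s + (x - s) * y) `^ a)
    (w y * (a * (s + (x - s) * y) `^ (a - 1) * y)).
Proof.
move=> s0 sx.
have [yI|yI] := boolP (y \in `]0, 1[); last first.
  rewrite (_ : (fun _ => _) = cst 0).
    by rewrite volterra_weight_itv// mul0r; exact: is_derive_cst.
  by apply/funext => z; rewrite volterra_weight_itv// mul0r.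
have dq : is_derive x 1 (fun x => s + (x - s) * y) y.
  rewrite (_ : (fun _ => _) = cst (s - s * y) + (y \*: id)).
    by apply: is_derive_eq; rewrite add0r /GRing.scale/= mulr1.
  by apply/funext => z; rewrite -[RHS]/(s - s * y + y * z); ring.
have := @is_derive1_comp _ (@powR R ^~ a) _ x _ _ (is_derive1_powR a (q_gt0 s0 sx yI)) dq.
by move=> /(@is_deriveZ _ _ _ _ (w y)).
Qed.

(** For x > s the base is at least s > 0 and a - 1 <= 0, so the derivative of the integrand is
    dominated by a s^(a - 1) w, uniformly in x. *)
Let is_derive_integral (s t : R) : 0 < s -> s < t ->
  is_derive t 1 (fun x => \int[mu]_y (w y * (s + (x - s) * y) `^ a))
    (\int[mu]_y (w y * (a * (s + (t - s) * y) `^ (a - 1) * y))).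
Proof.
move=> s0 st.
pose f x y := w y * (s + (x - s) * y) `^ a.
have tI : `]s, (t + 1)[%classic t by rewrite /= in_itv/= st ltrDl ltr01.
have intf x : `]s, (t + 1)[%classic x -> mu.-integrable setT (EFin \o f x).
  by rewrite /= in_itv/= => /andP[sx _]; apply: integrable_wq; exact: ltW.
have dfE x y : `]s, (t + 1)[%classic x ->
    is_derive x 1 (f ^~ y) (w y * (a * (s + (x - s) * y) `^ (a - 1) * y)).
  by rewrite /= in_itv/= => /andP[sx _]; exact: is_derive_integrand.
have df x y : `]s, (t + 1)[%classic x -> setT y -> derivable (f ^~ y) x 1.
  by move=> xI _; case: (dfE x y xI).
pose G y := a * s `^ (a - 1) * w y.
have G0 y : 0 <= G y.
  by rewrite !mulr_ge0 ?powR_ge0 ?volterra_weight_ge0// ltW.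
have iG : mu.-integrable setT (EFin \o G).
  by apply: integrable_EFinZl => //; exact: volterra_weight_integrable.
have fG x y : `]s, (t + 1)[%classic x -> setT y -> `|partial1of2 f x y| <= G y.
  move=> xI _; rewrite partial1of2E; case: (dfE x y xI) => _ ->; rewrite /G.
  have [yI|yI] := boolP (y \in `]0, 1[); last first.
    by rewrite volterra_weight_itv// mul0r mulr0 normr0.
  move: xI; rewrite /= in_itv/= => /andP[sx _].
  have /andP[sq _] := q_itv (ltW sx) yI.
  move: yI; rewrite in_itv/= => /andP[y0 y1].
  rewrite ger0_norm; last first.
    by rewrite !mulr_ge0 ?powR_ge0 ?volterra_weight_ge0// ltW.
  rewrite mulrC ler_wpM2r ?volterra_weight_ge0// -mulrA ler_wpM2l ?(ltW a_gt0)//.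
  apply: le_trans (powR_ndecr a_le1 s0 sq).
  by rewrite ler_piMr ?powR_ge0// ltW.
have d1E y : derive1 (f ^~ y) t = w y * (a * (s + (t - s) * y) `^ (a - 1) * y).
  by rewrite derive1E; case: (dfE t y tI).
apply: DeriveDef.
  exact: (derivable_under_integral measurableT tI intf df G0 iG fG).
rewrite -derive1E (differentiation_under_integral measurableT tI intf df G0 iG fG).
by apply: eq_Rintegral => y _; rewrite /partial1of2 d1E.
Qed.

Lemma dK_kerN (s t : R) : 0 < s -> s < t ->
  dK H1 H2 t s = beta_coef H2 * a * s `^ (1 / 2 - H2) *
    (t - s) `^ (a - 1) * kerN a w t s.
Proof.
move=> s0 st; have ts0 : 0 < t - s by rewrite subr_gt0.
pose I x := \int[mu]_y (w y * (s + (x - s) * y) `^ a).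
(* Since q^(a - 1) (q + (t - s) y) = q^a + (t - s) y q^(a - 1), the difference [kerN - I] is (t - s)
   / a times this integral. The product rule then collapses to a (t - s)^(a - 1) [kerN]. *)
have dIE : \int[mu]_y (w y * (a * (s + (t - s) * y) `^ (a - 1) * y)) =
    a / (t - s) * (kerN a w t s - I t).
  have iN : mu.-integrable setT (EFin \o kerN_integrand a w t s).
    apply: kerN_integrable => //; [exact: volterra_weight_ge0
      |exact: volterra_weight_itv|exact: volterra_weight_integrable
      |exact: ltW|exact: ltW|exact: lt_trans st].
  have iI := integrable_wq (ltW s0) (ltW st).
  rewrite -RintegralB// -RintegralZl//; last exact: integrable_EFinB.
  apply: eq_Rintegral => y _; rewrite /kerN_integrand.
  have [yI|yI] := boolP (y \in `]0, 1[); last by rewrite volterra_weight_itv//; ring.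
  have q0 := q_gt0 s0 st yI.
  rewrite -(mulr_powRB1 (ltW q0) a_gt0) ger0_norm; last first.
    move: yI; rewrite in_itv/= => /andP[y0 _].
    by rewrite addr_ge0 ?mulr_ge0 ?ltW.
  by field; rewrite lt0r_neq0.
have dpow : is_derive t 1 (fun x => (x - s) `^ a) (a * (t - s) `^ (a - 1)).
  have dB : is_derive t 1 (fun x => x - s) 1.
    by apply: is_derive_eq; rewrite subr0.
  have := @is_derive1_comp _ (@powR R ^~ a) _ t _ _ (is_derive1_powR a ts0) dB.
  by rewrite mulr1.
have := is_deriveM dpow (is_derive_integral s0 st).
move=> /(@is_deriveZ _ _ _ _ (beta_coef H2 * s `^ (1 / 2 - H2))) dF.
(* The factored form of [K] is available only for x > s, which is a neighbourhood of t. *)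
have /near_eq_is_derive/(_ dF)[_] : \near t, (beta_coef H2 * s `^ (1 / 2 - H2) \*:
    ((fun x => (x - s) `^ a) * I)) t = K H1 H2 t s.
  near=> x; rewrite K_volterra_weight//.
  by near: x; exact: lt_nbhsr.
rewrite /dK derive1E => ->; rewrite dIE -/(I t) /GRing.scale/=.
rewrite -(mulr_powRB1 (ltW ts0) a_gt0).
by field; rewrite lt0r_neq0.
Unshelve. all: by end_near. Qed.

End volterra_kernel_derivative.

(** * The kernel kappa as an averaged kernel *)

Lemma ge0_RintegralZl d (X : measurableType d) (R : realType)
    (mu : {measure set X -> \bar R}) (D : set X) (r : R) (f : X -> R) :
  measurable D -> measurable_fun D f -> (forall x, D x -> 0 <= f x) -> 0 < r ->
  \int[mu]_(x in D) (r * f x) = r * \int[mu]_(x in D) f x.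
Proof.
move=> mD mf f0 r0; rewrite /Rintegral.
under eq_integral do rewrite EFinM.
rewrite ge0_integralZl//; last 2 first.
- exact/measurable_EFinP.
- by rewrite lee_fin ltW.
case: (integral _ _ _) => [x||]//=.
  by rewrite gt0_muley ?lte_fin// mulr0.
by rewrite gt0_muleNy ?lte_fin// mulr0.
Qed.

Lemma Rintegral_subset_le d (X : measurableType d) (R : realType)
    (mu : {measure set X -> \bar R}) (D : set X) (f : X -> R) :
  measurable D -> mu.-integrable setT (EFin \o f) -> (forall x, 0 <= f x) ->
  \int[mu]_(x in D) f x <= \int[mu]_x f x.
Proof.
move=> mD jf f0; rewrite Rintegral_mkcond; apply: le_Rintegral => //.
  by apply: integrable_EFin_patch => //; exact: integrableS jf.
by move=> x _; rewrite patchE; case: ifP.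
Qed.

Section kappa_representation.
Context {R : realType}.
Local Notation mu := (@lebesgue_measure R).
Variables (H1 H2 T : R).
Hypothesis hH1 : 1 / 2 <= H1.
Hypothesis hH12 : H1 < H2.
Hypothesis hH2 : H2 < 1.
Local Notation a := (H2 - H1).
Local Notation b := (1 / 2 - H2).
Local Notation w := (volterra_weight H1 H2).
Local Notation N := (kerN a w).
Local Notation M := (kerM a T w).

(** What depends on z alone after v = u z: each derivative contributes z^(1/2 - H2), and the one at
    u also (1 - z)^(a - 1) and N(1, z). *)
Definition kappa_weight : R -> R :=
  (fun z => (beta_coef H2 * a) ^+ 2 * (z `^ (1 - 2 * H2) * (1 - z) `^ (a - 1)) * N 1 z)
    \_ `]0, 1[.
Local Notation p := kappa_weight.
Local Notation kap := (averaged_kernel p M).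

Let a_gt0 : 0 < a. Proof. by rewrite subr_gt0. Qed.

Let a_le1 : a - 1 <= 0. Proof. by move: hH1 hH2 => *; lra. Qed.

Let w_ge0 := @volterra_weight_ge0 R H1 H2.
Let w_itv := @volterra_weight_itv R H1 H2.
Let iw := @volterra_weight_integrable R H1 H2 hH1 hH12 hH2.

Let N_ge0 t s : 0 <= N t s. Proof. exact: kerN_ge0. Qed.

Let M_ge0 s v : 0 <= M s v. Proof. exact: kerM_ge0. Qed.

Lemma kappa_weight_ge0 z : 0 <= p z.
Proof.
rewrite /p patchE; case: ifP => // _; apply: mulr_ge0; last exact: N_ge0.
by apply: mulr_ge0; [exact: sqr_ge0|rewrite mulr_ge0 ?powR_ge0].
Qed.

Lemma kappa_weight_itv z : z \notin `]0, 1[ -> p z = 0.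
Proof.
by move=> zI; rewrite /p patchE ifF//; apply: contraNF zI => /set_mem.
Qed.

Let mN (t : R) : measurable_fun setT (fun s : R => N t s).
Proof.
exact: (measurableT_comp (measurable_kerN a w_ge0 iw) (pair1_measurable t)).
Qed.

Lemma kappa_weight_integrable : mu.-integrable setT (EFin \o p).
Proof.
apply: integrable_EFin_patch => //.
pose c := (beta_coef H2 * a) ^+ 2.
pose W := 2 * 1 `^ a * \int[mu]_y w y.
have ib : mu.-integrable `]0, 1[ (EFin \o (fun z : R =>
    c * W * (z `^ (1 - 2 * H2) * (1 - z) `^ (a - 1)))).
  apply: integrable_EFinZl => //.
  (* Again a beta weight, with parameters 2 - 2 H2 and a; here H2 < 1 ensures integrability at 0 and
     H1 < H2 at 1. *)
  have -> : 1 - 2 * H2 = (2 - 2 * H2) - 1 by ring.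
  by move: hH1 hH12 hH2 => *; apply: integrable_beta; apply/andP; split; lra.
apply: le_integrable ib => //.
  apply/measurable_EFinP/measurable_funTS; apply: measurable_funM; last exact: mN.
  apply: measurable_funM => //; apply: measurable_funM; first exact: measurable_powR.
  by apply: (measurableT_comp (measurable_powR _)); exact: measurable_funB.
move=> z; rewrite /= in_itv/= => /andP[z0 z1].
have NW : N 1 z <= W by apply: kerN_le => //; exact: ltW.
have g0 : 0 <= z `^ (1 - 2 * H2) * (1 - z) `^ (a - 1).
  by rewrite mulr_ge0 ?powR_ge0.
have W0 : 0 <= W := le_trans (N_ge0 1 z) NW.
have c0 : 0 <= c by exact: sqr_ge0.
have l0 := mulr_ge0 (mulr_ge0 c0 g0) (N_ge0 1 z).
have r0 := mulr_ge0 (mulr_ge0 c0 W0) g0.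
rewrite lee_fin -/c (ger0_norm l0) (ger0_norm r0) [leRHS]mulrAC.
by apply: ler_wpM2l NW; exact: mulr_ge0.
Qed.

Let kerN_homogeneous (u z : R) : 0 < u -> 0 <= z <= 1 ->
  N u (u * z) = u `^ a * N 1 z.
Proof.
move=> u0 /andP[z0 z1].
rewrite /kerN -RintegralZl//; last by apply: kerN_integrable.
apply: eq_Rintegral => y _; rewrite /kerN_integrand.
have [yI|yI] := boolP (y \in `]0, 1[); last by rewrite w_itv//; ring.
move: yI; rewrite in_itv/= => /andP[y0 y1].
have -> : u * z + (u - u * z) * y = u * (z + (1 - z) * y) by ring.
have -> : u * z + 2 * (u - u * z) * y = u * (z + 2 * (1 - z) * y) by ring.
have q0 : 0 <= z + (1 - z) * y by rewrite addr_ge0// mulr_ge0 ?subr_ge0// ltW.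
rewrite normrM (gtr0_norm u0) (powRM _ (ltW u0) q0).
by rewrite -(mulr_powRB1 (ltW u0) a_gt0); ring.
Qed.

(** The range 0 < u z < min(s, u) splits into z in ]0, 1[, the support of p, and u z < s, the
    indicator in M. *)
Lemma kappaE_pos (s u : R) : 0 < s -> s <= T -> 0 < u -> s != u ->
  u `^ (2 * H1 - 1) * kker H1 H2 s u = kap s u.
Proof.
move=> s0 sT u0 su.
(* The formula for [dK], taken at all arguments: there it is measurable and nonnegative, as the
   substitution lemma requires. *)
pose dker t v := beta_coef H2 * a * v `^ b * (t - v) `^ (a - 1) * N t v.
have dker_ge0 t v : 0 <= dker t v.
  apply: mulr_ge0 (N_ge0 t v); rewrite !mulr_ge0 ?powR_ge0//; last exact: ltW.
  exact: sqrtr_ge0.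
have mdker t : measurable_fun setT (dker t).
  apply: measurable_funM => //; apply: measurable_funM.
    by apply: measurable_funM => //; exact: measurable_powR.
  by apply: (measurableT_comp (measurable_powR _)); exact: measurable_funB.
have -> : kker H1 H2 s u =
    \int[mu]_(v in `]0, Num.min s u[) (dker s v * dker u v).
  apply: eq_Rintegral => v; rewrite inE/= in_itv/= lt_min => /and3P[v0 vs vu].
  by rewrite !dK_kerN.
have mdd : measurable_fun setT (fun v => dker s v * dker u v) by exact: measurable_funM.
rewrite (Rintegral_affine 0 (lt0r_neq0 u0) (gtr0_norm u0) (measurable_itv _)); last 2 first.
- exact: measurable_funTS.
- by move=> v _; rewrite mulr_ge0.
have mphi : measurable_fun setT (fun y : R => 0 + u * y).
  by apply: measurable_funD => //; exact: measurable_funM.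
rewrite mulrA -ge0_RintegralZl; last 4 first.
- rewrite -[X in measurable X]setTI; apply: mphi => //.
- by apply: measurable_funTS; exact: (measurableT_comp mdd mphi).
- by move=> z _; rewrite mulr_ge0.
- by rewrite mulr_gt0 ?powR_gt0.
rewrite Rintegral_mkcond /averaged_kernel; apply: eq_Rintegral => z _.
rewrite patchE; case: ifPn => [|zI].
  rewrite inE/= in_itv/= add0r pmulr_rgt0// lt_min => /and3P[z0 uzs].
  rewrite gtr_pMr// => z1.
  rewrite /kerM uzs sT/= /kappa_weight patchE mem_set; last by rewrite /= in_itv/= z0.
  have zz : 0 <= z <= 1 by apply/andP; split; exact: ltW.
  rewrite /dker (kerN_homogeneous u0 zz).
  have -> : u - u * z = u * (1 - z) by ring.
  have z1' : 0 <= 1 - z by rewrite subr_ge0 ltW.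
  rewrite (powRM b (ltW u0) (ltW z0)) (powRM (a - 1) (ltW u0) z1').
  have z2b : z `^ (1 - 2 * H2) = z `^ b * z `^ b.
    rewrite -powRD; first by congr powR; field.
    by rewrite (lt0r_neq0 z0) implybT.
  (* The exponents of the prefactor, the Jacobian, the two factors v^b, the singular factor and N
     add up to 0. *)
  have uE : u `^ (2 * H1 - 1) * u * (u `^ b * u `^ b * u `^ (a - 1) * u `^ a) = 1.
    have uD e f : u `^ e * u `^ f = u `^ (e + f).
      by rewrite powRD// (lt0r_neq0 u0) implybT.
    transitivity (u `^ (2 * H1 - 1) * u `^ 1 *
        (u `^ b * u `^ b * u `^ (a - 1) * u `^ a)); first by rewrite (powRr1 (ltW u0)).
    by rewrite !uD; transitivity (u `^ 0); [congr powR; field|exact: powRr0].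
  by rewrite z2b -[RHS]mul1r -[X in _ = X * _]uE; ring.
have [z01|z01] := boolP (z \in `]0, 1[); last by rewrite kappa_weight_itv// mul0r.
rewrite /kerM; case: ifPn => [/andP[uzs _]|_]; last by rewrite mulr0.
exfalso; move/negP: zI; apply; move: z01; rewrite in_itv/= => /andP[z0 z1].
by rewrite inE/= in_itv/= add0r mulr_gt0// lt_min uzs gtr_pMr.
Qed.

Let kap_cvg0 (s : R) (u_ : nat -> R) : 0 < s -> s <= T -> (forall n, 0 < u_ n) ->
  u_ n @[n --> \oo] --> 0 -> kap s (u_ n) @[n --> \oo] --> kap s 0.
Proof.
move=> s0 sT u_0 cu_.
have s20 : 0 < s / 2 by rewrite divr_gt0.
(* The cap at s / 2 keeps v_n z away from the singularity at s, so that (s - v_n z)^(a - 1) <= (s /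
   2)^(a - 1); it alters only finitely many terms. *)
pose v_ n := Num.min (u_ n) (s / 2).
have v_0 n : 0 < v_ n by rewrite lt_min u_0.
have v_s n : v_ n <= s / 2 by rewrite ge_min lexx orbT.
have u_v : \forall n \near \oo, v_ n = u_ n.
  by near=> n; rewrite /v_ min_l// ltW//; near: n; exact: (cvgr_lt 0).
have cv_ : v_ n @[n --> \oo] --> 0.
  by apply: (cvg_trans _ cu_); apply: near_eq_cvg; apply: filterS u_v => n ->.
apply: (@cvg_trans _ (kap s (v_ n) @[n --> \oo])).
  by apply: near_eq_cvg; apply: filterS u_v => n ->.
have mMu u : measurable_fun setT (fun z : R => p z * M s (u * z)).
  apply: measurable_funM.
    by apply/measurable_EFinP; exact: measurable_int kappa_weight_integrable.
  apply: (measurableT_comp (f := fun v => M s v)); last exact: measurable_funM.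
  exact: (measurableT_comp (measurable_kerM a T w_ge0 iw) (pair1_measurable s)).
pose c := (s / 2) `^ (a - 1) * (2 * s `^ a * \int[mu]_y w y).
have vz_itv n z : z \in `]0, 1[ -> 0 <= v_ n * z <= s / 2.
  rewrite in_itv/= => /andP[z0 z1]; apply/andP; split.
    by rewrite ltW// mulr_gt0.
  by apply: le_trans (v_s n); rewrite ler_piMr// ltW.
apply: (@dominated_cvg_Rintegral _ _ _ mu _ measurableT
  (fun n z => p z * M s (v_ n * z)) _ (fun z => c * p z)) => //.
- by move=> n; exact: mMu.
- exact: mMu.
- apply: aeW => z _; have [zI|zI] := boolP (z \in `]0, 1[); last first.
    rewrite (_ : (fun n => _) = cst 0); last first.
      by apply/funext => n; rewrite kappa_weight_itv// mul0r.
    by rewrite kappa_weight_itv// mul0r; exact: cvg_cst.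
  apply: cvgMr; rewrite mul0r.
  have xE n : M s (v_ n * z) = (s - v_ n * z) `^ (a - 1) * N s (v_ n * z).
    rewrite /kerM sT andbT ifT//.
    have /andP[_ h] := vz_itv n z zI; move: s0 => ?; lra.
  under eq_fun do rewrite xE.
  rewrite /kerM s0 sT/=.
  have cx : v_ n * z @[n --> \oo] --> 0.
    by rewrite -[X in _ --> X](mul0r z); exact: cvgMl.
  apply: cvgM.
    by apply: powR_cvg; [rewrite subr0|apply: cvgB => //; exact: cvg_cst].
  apply: (@kerN_cvg _ a w a_gt0 w_ge0 w_itv iw (fun=> s) (fun n => v_ n * z) s 0 s) => //.
  + move=> n; have /andP[h1 h2] := vz_itv n z zI; move: s0 => ?; split => //; lra.
  + exact: ltW.
  + exact: cvg_cst.
- by apply: integrable_EFinZl => //; exact: kappa_weight_integrable.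
- move=> n z _; rewrite ger0_norm ?mulr_ge0 ?kappa_weight_ge0//.
  have [zI|zI] := boolP (z \in `]0, 1[); last by rewrite kappa_weight_itv// mul0r mulr0.
  have /andP[h1 h2] := vz_itv n z zI.
  rewrite mulrC ler_wpM2r ?kappa_weight_ge0// /kerM sT andbT ifT; last first.
    by move: s0 => ?; lra.
  apply: ler_pM => //; first exact: powR_ge0.
    by apply: powR_ndecr => //; move: s0 => ?; lra.
  by apply: kerN_le => //; move: s0 => ?; lra.
Unshelve. all: by end_near. Qed.

(** At u = 0 [kappa] is a [lim], so actual convergence as u decreases to 0 has to be supplied, here
    along sequences. *)
Lemma kappa_averaged (s u : R) : 0 < s -> s <= T -> 0 <= u -> s != u ->
  kappa H1 H2 s u = kap s u.
Proof.
move=> s0 sT; rewrite le_eqVlt => /predU1P[<-|u0] su; last first.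
  by rewrite /kappa (negbTE su) gt_eqF//; exact: kappaE_pos.
rewrite /kappa (negbTE su) eqxx; apply/cvg_lim => //.
apply/cvg_at_rightP => u_ [u_0 cu_].
apply: (cvg_trans _ (kap_cvg0 s0 sT u_0 cu_)).
apply: near_eq_cvg; near=> n.
rewrite kappaE_pos// gt_eqF//; near: n.
by apply: (cvgr_lt 0).
Unshelve. all: by end_near. Qed.

Lemma kappa_integral_operator : 0 < T -> exists A : {linear C0T T -> C0T T},
  is_integral_operator kap A /\ compact_operator A.
Proof.
move=> T0.
have ge0 v : v \in `[0, T] -> 0 <= v by rewrite in_itv/= => /andP[].
have p_itv z : z \notin `[0, 1] -> p z = 0.
  move=> zI; apply: kappa_weight_itv; apply: contra zI.
  by rewrite !in_itv/= => /andP[? ?]; rewrite !ltW.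
have mM := @measurable_kerM R a T w w_ge0 iw.
have iM v : v \in `[0, T] -> mu.-integrable setT (EFin \o M ^~ v).
  by move=> /ge0 v0; apply: kerM_integrable.
have Mle v (vT : v \in `[0, T]) := @kerM_le R a T w a_gt0 w_ge0 w_itv iw v (ge0 v vT).
have Mcvg := @kerM_cvg R a T w a_gt0 w_ge0 w_itv iw.
have ikap := @averaged_kernel_integrable R T _ p M kappa_weight_ge0 p_itv
  kappa_weight_integrable M_ge0 mM iM Mle.
have ckap := @averaged_kernel_cvg R T _ p M kappa_weight_ge0 p_itv
  kappa_weight_integrable M_ge0 mM iM Mle Mcvg.
apply: integral_operator_compact => [u uT|u e uT e0].
  by apply: (integrableS measurableT) => //; exact: ikap.
(* Sends points outside [0, T] to the limit point, so that sequences in R tending to [u] become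
   sequences in [0, T] and the sequential result yields a neighbourhood statement. *)
pose phi x := if x \in `[0, T] then x else u.
have phiT x : phi x \in `[0, T] by rewrite /phi; case: ifP.
pose G x := \int[mu]_s `|kap s (phi x) - kap s u|.
have cG : G x @[x --> u] --> 0.
  apply/(@cvg_nbhsP _ R^o) => u_ cu_; apply: ckap => //.
  apply/(@cvgrPdist_lt _ R^o) => d d0.
  have /(@cvgrPdist_lt _ R^o)/(_ _ d0) := cu_.
  by apply: filterS => n; rewrite /phi; case: ifP => // _ _; rewrite subrr normr0.
have /(@cvgrPdist_lt _ R^o)/(_ _ e0) := cG.
apply: filterS => u'; rewrite sub0r normrN => Gu' u'T.
apply: le_lt_trans Gu'; rewrite ger0_norm; last by apply: Rintegral_ge0.
rewrite /G /phi u'T.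
have ik : mu.-integrable setT (EFin \o (fun s => `|kap s u - kap s u'|)).
  exact: (integrable_norm (integrable_EFinB measurableT (ikap _ uT) (ikap _ u'T))).
under [leRHS]eq_Rintegral do rewrite distrC.
apply: (@Rintegral_subset_le _ _ _ mu `[0, T]%classic _ (measurable_itv _) ik) => s.
exact: normr_ge0.
Qed.

End kappa_representation.

(** * Exceptional points and conclusion *)

(** Measurability of [f] is part of the gain: [f] is [g] altered at one point. The integrand with
    [kappa] inherits its measurability in this way. *)
Lemma integrable_eq_except1 (R : realType) (D : set R) (f g : R -> R) (r : R) :
  let mu := @lebesgue_measure R in
  measurable D -> (forall s, D s -> s != r -> f s = g s) ->
  mu.-integrable D (EFin \o g) ->
  mu.-integrable D (EFin \o f) /\
  \int[mu]_(s in D) f s = \int[mu]_(s in D) g s.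
Proof.
move=> mu mD fg ig.
have mg : measurable_fun D g by apply/measurable_EFinP; exact: measurable_int ig.
have mf : measurable_fun D f.
  apply: (@eq_measurable_fun _ _ _ _ _ (fun s => if s == r then f r else g s)).
    move=> s; rewrite inE => Ds; case: eqVneq => [->//|sr].
    exact/esym/fg.
  apply: measurable_fun_if => //.
    exact: measurable_fun_eqr.
  by apply: measurable_funS mg.
have aefg (h : \bar R -> \bar R) : ae_eq mu D (h \o (EFin \o f)) (h \o (EFin \o g)).
  exists [set r]; split => //; first exact: lebesgue_measure_set1.
  move=> s /= nfg; apply: contrapT => /eqP sr; apply: nfg => Ds.
  by rewrite /= fg.
split; last first.
  congr fine; apply: ae_eq_integral => //; [exact/measurable_EFinP|exact/measurable_EFinP|].
  exact: (aefg id).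
have /integrableP[_ gy] := ig.
apply/integrableP; split; first exact/measurable_EFinP.
have -> // : (\int[mu]_(x in D) `|(EFin \o f) x| = \int[mu]_(x in D) `|(EFin \o g) x|)%E.
apply: ae_eq_integral => //; last exact: (aefg abse).
- by apply: measurableT_comp => //; exact/measurable_EFinP.
- by apply: measurableT_comp => //; exact/measurable_EFinP.
Qed.

Theorem lemma3 (R : realType) (H1 H2 T : R)
    (hH1 : 1 / 2 <= H1) (hH12 : H1 < H2) (hH2 : H2 < 1) (hT : 0 < T) :
  exists A : {linear C0T T -> C0T T},
    is_integral_operator (kappa H1 H2) A /\ compact_operator A.
Proof.
have [A [Akap cA]] := kappa_integral_operator hH1 hH12 hH2 hT.
exists A; split=> // x u f.
have [ikap ->] := Akap x u.
set kap := averaged_kernel _ _ in ikap *.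
(* The averaged formula is known for s > 0 with s != u. The intermediate [g] removes the two
   exceptional points one at a time, first s = 0 and then s = u. *)
pose g s := if s == 0 then f 0 else kap s (set_val u) * 'valL_0 x s.
have [||ig <-] := @integrable_eq_except1 R `[0, T]%classic g _ 0 _ _ ikap.
- exact: measurable_itv.
- by move=> s _ s0; rewrite /g (negbTE s0).
have [//||iff <-//] := @integrable_eq_except1 R `[0, T]%classic f g (set_val u) _ _ ig.
move=> s; rewrite /= in_itv/= => /andP[s0 sT] su; rewrite /g.
have [->//|sn0] := eqVneq s 0.
rewrite /f (@kappa_averaged _ _ _ T)// ?lt0r ?sn0//.
by have := set_mem (valP u); rewrite /= in_itv/= => /andP[].
Qed.
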